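(* Let $f(x)=x^4+ax^2+bx+c\in\mathbb{Z}[x]$ be irreducible with $a$ odd and $b,c$ even (equivalently, $f(x)\equiv x^2(x+1)^2\pmod 2$). Let $\theta$ be a root of $f(x)$ in an algebraic closure of $\mathbb{Q}$ and $K=\mathbb{Q}(\theta)$. For a regular integer $s$ put $\alpha=\theta^3+s\theta^2+(a+s^2)\theta+s^3+as+b$ and $\nu=\lfloor\min\{v_2(f(s))/2,\,v_2(f'(s))\}\rfloor$. Then a $2$-integral basis of $K$ is given as follows: (1) if $v_2(c)=1$ and $v_2(a+b+c+1)=1$: $\ 1,\theta,\theta^2,\theta^3$; (2) if $v_2(c)=1$ and $v_2(a+b+c+1)>1$: $\ 1,\theta,\theta^2,\alpha/2^{\nu}$, where $s$ is any odd regular integer; (3) if $v_2(c)>1$ and $v_2(a+b+c+1)=1$: $\ 1,\theta,\theta^2,\alpha/2^{\nu}$, where $s$ is any even regular integer; (4) if $v_2(c)>1$ and $v_2(a+b+c+1)>1$: $\ 1,\theta,(\theta^2+\theta)/2,\alpha/2^{\nu}$, where $s$ is any odd regular integer if $a\equiv1\pmod4$, and any even regular integer if $a\equiv3\pmod 4$.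
   Context: $v_2$ is the $2$-adic valuation, $v_2(0)=\infty$. A $2$-integral basis of $K$ is a family of elements of $K$ that is a $\mathbb{Z}_{(2)}$-basis of $\mathbb{Z}_K\otimes_{\mathbb{Z}}\mathbb{Z}_{(2)}$, where $\mathbb{Z}_K$ is the ring of integers of $K$ and $\mathbb{Z}_{(2)}$ the localization of $\mathbb{Z}$ at $2$. Regular integers (with $p=2$). For $s\in\mathbb{Z}$ write $f(x)=\sum_{i=0}^4 A_i(x-s)^i$, $A_i=f^{(i)}(s)/i!\in\mathbb{Z}$, $u_i=v_p(A_i)$. Let $N^-_{x-s}(f)$ be the union of the sides of negative slope of the lower convex envelope of the points $(i,u_i)$, $0\le i\le4$, $u_i<\infty$. For an integer abscissa $i$ put $c_i=\overline{A_i/p^{u_i}}\in\mathbb{F}_p$ if $(i,u_i)$ lies on $N^-_{x-s}(f)$ and $c_i=0$ otherwise. A side of slope $-h/e$ ($h,e$ positive coprime), initial abscissa $i_0$ and horizontal length $de$ has residual polynomial $c_{i_0}+c_{i_0+e}y+\cdots+c_{i_0+de}y^d\in\mathbb{F}_p[y]$. The integer $s$ is regular if the residual polynomials of all sides of $N^-_{x-s}(f)$ are separable. *)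

(* Defs.v *)
From HB Require Import structures.
From mathcomp Require Import all_boot all_order all_algebra all_field.
From mathcomp Require Import constructive_ereal.

Set Implicit Arguments.
Unset Strict Implicit.
Unset Printing Implicit Defensive.
Import Order.TTheory GRing.Theory Num.Theory.
Local Open Scope ring_scope.

Definition valuation (p : nat) (z : int) : \bar rat :=
  if z == 0 then +oo%E else ((logn p `|z|%N)%:R : rat)%:E.

Definition quartic (a b c : int) : {poly int} :=
  'X^4 + a *: 'X^2 + b *: 'X + c%:P.

(* The Newton polygon of f at s. Only the points (i, height p f s i) with
   0 <= i <= 4 and taylor_coef f s i != 0 are considered: for a zero
   coefficient the ordinate is infinite and the value of height is junk. *)

Definition taylor_coef (f : {poly int}) (s : int) (i : nat) : int :=
  f^`N(i).[s].

Definition height (p : nat) (f : {poly int}) (s : int) (i : nat) : nat :=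
  logn p `|taylor_coef f s i|%N.

Definition slope (p : nat) (f : {poly int}) (s : int) (i j : nat) : rat :=
  ((height p f s j)%:R - (height p f s i)%:R) / (j%:R - i%:R).

(* Ordinate at abscissa k of the line through the points of abscissas i, j. *)
Definition chord (p : nat) (f : {poly int}) (s : int) (i j k : nat) : rat :=
  (height p f s i)%:R + slope p f s i j * (k%:R - i%:R).

(* The sides of the lower convex envelope are its maximal segments: the line
   supporting a side has no point strictly below it, and the points that lie
   on it have their abscissas between those of the endpoints of the side. *)
Definition is_side (p : nat) (f : {poly int}) (s : int) (i j : nat) : bool :=
  [&& (i < j)%N, taylor_coef f s i != 0, taylor_coef f s j != 0 &
    [forall k : 'I_5, (taylor_coef f s k != 0) ==>
      (chord p f s i j k <= (height p f s k)%:R) &&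
      ((chord p f s i j k == (height p f s k)%:R) ==> (i <= k <= j)%N)]].

Definition is_neg_side (p : nat) (f : {poly int}) (s : int) (i j : nat) :
    bool :=
  is_side p f s i j && (slope p f s i j < 0).

Definition on_neg_polygon (p : nat) (f : {poly int}) (s : int) (k : nat) :
    bool :=
  (taylor_coef f s k != 0) &&
  [exists i : 'I_5, [exists j : 'I_5,
    [&& is_neg_side p f s i j, (i <= k <= j)%N &
        chord p f s i j k == (height p f s k)%:R]]].

Definition residual_coef (p : nat) (f : {poly int}) (s : int) (k : nat) :
    'F_p :=
  if on_neg_polygon p f s k
  then ((taylor_coef f s k %/ (p ^ height p f s k)%N%:Z)%Z)%:~R else 0.

(* For a side of slope - h / e in lowest terms and horizontal length d * e,
   e is the denominator of the slope. *)
Definition residual_poly (p : nat) (f : {poly int}) (s : int) (i j : nat) :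
    {poly 'F_p} :=
  let e := `|denq (slope p f s i j)|%N in
  let d := ((j - i) %/ e)%N in
  \poly_(k < d.+1) residual_coef p f s (i + k * e).

Definition regular (p : nat) (f : {poly int}) (s : int) : Prop :=
  forall i j : 'I_5, is_neg_side p f s i j ->
    separable_poly (residual_poly p f s i j).

(* The subfield Q(theta) of algC. *)
Definition in_Qadjoin (theta x : algC) : Prop :=
  exists g h : {poly rat}, (map_poly ratr h).[theta] != 0 /\
    x = (map_poly ratr g).[theta] / (map_poly ratr h).[theta].

Definition in_ring_of_integers (theta x : algC) : Prop :=
  in_Qadjoin theta x /\ x \in Aint.

Definition in_Z2 (q : rat) : Prop := odd `|denq q|%N.

(* Z_K (x) Z_(2) is identified with its image in K under z (x) q |-> q z, that
   is, with the localization of Z_K at the odd integers. *)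
Definition in_2_integers (theta x : algC) : Prop :=
  exists (z : algC) (m : nat),
    [/\ in_ring_of_integers theta z, odd m & x = z / m%:R].

Definition is_2_integral_basis (theta : algC) (n : nat) (w : n.-tuple algC) :
    Prop :=
  [/\ forall i : 'I_n, in_2_integers theta (tnth w i),
      forall x : algC, in_2_integers theta x ->
        exists q : 'I_n -> rat, (forall i, in_Z2 (q i)) /\
          x = \sum_(i < n) ratr (q i) * tnth w i
    & forall q : 'I_n -> rat, (forall i, in_Z2 (q i)) ->
        \sum_(i < n) ratr (q i) * tnth w i = 0 -> forall i, q i = 0].

Definition alpha (a b s : int) (theta : algC) : algC :=
  theta ^+ 3 + s%:~R * theta ^+ 2 + (a + s ^+ 2)%:~R * theta
  + (s ^+ 3 + a * s + b)%:~R.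

Definition nu (f : {poly int}) (s : int) : int :=
  Num.floor (fine (mine (valuation 2 f.[s] / (2%:R : rat)%:E)
                        (valuation 2 f^`().[s]))%E).

(* Main.v *)
Require Import Defs.
From mathcomp Require Import all_boot all_order all_algebra all_field.
From mathcomp Require Import constructive_ereal ring lra zify.

Import Order.TTheory GRing.Theory Num.Theory.
Local Open Scope ring_scope.

(** Write t = theta - s, let A_i be the Taylor coefficients of f at s, and put
    y = alpha / 2^nu, B0 = A_0 / 4^nu and B1 = A_1 / 2^nu. Since f = x^2 (x + 1)^2
    modulo 2, the 2-adic completion of K splits into a part where t is not a unit,
    the place of s, and a part where t - 1 is not one, the place of s + 1. At the
    place of s, t is approximately a root of the quadratic polynomial
    A_2 x^2 + A_1 x + A_0, and the regularity of s says exactly that this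
    polynomial, rescaled to A_2 Y^2 + B1 Y + B0, is separable modulo 2 or of
    Eisenstein type at 2 (regular_maximal). Either way its order is maximal.

    This is made precise without completions, inside the ring of 2-integral
    algebraic numbers. The element y is integral (int2_alpha). Modulo 2, t^2 + 1 and
    t^2 are orthogonal idempotents (even2_idem), and t y is even
    (even2_mul_root_scaled_alpha), so that t^2 + 1 fixes y and t^2 kills it. The key
    point is that (p (t^2 + 1) + q y) / 2 is 2-integral only for even p and q
    (local_independence), by a norm and a trace computation over the conjugates of
    theta. Let y' be the element like y for a suitable power of 2 at s + 1, where the
    same dichotomy holds. Separating the places by the idempotents, the four elements
    t^2 + 1, t^2, y, y' are independent modulo 2 in the 2-integral elements
    (global_independence). They form a basis of K over Q (local_basis_span), so
    dividing out powers of 2 one at a time shows that they are a 2-integral basis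
    (local_basis_Z2).

    It remains to compare this basis with the given families. At s + 1 the exponent
    of 2 is 0, with f(s + 1) = 2 modulo 4, when v(c) or v(a + b + c + 1) is 1 and s is
    chosen as stated (s = 0 will do if both are 1); it is 1, with f'(s + 1) = 2
    modulo 4, when both are larger. The difference of the alpha at s + 1 and at s is
    quadratic in theta, and this makes the change of basis explicit (alpha_basis). *)

(** * The ring of 2-integral algebraic numbers *)

(** This is the integral closure of Z_(2) in algC; membership of K = Q(theta) is
    kept apart, so that conjugates can be compared inside one ring. *)
Definition int2 (x : algC) : Prop := exists2 m : nat, odd m & m%:R * x \in Aint.

Lemma int2_Aint x : x \in Aint -> int2 x.
Proof. by move=> Ax; exists 1%N; rewrite ?mul1r. Qed.

Lemma int2_int (n : int) : int2 n%:~R.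
Proof. exact/int2_Aint/Aint_int. Qed.

Lemma int2D x y : int2 x -> int2 y -> int2 (x + y).
Proof.
move=> [m om Ax] [n on Ay]; exists (m * n)%N; first by rewrite oddM om.
have -> : (m * n)%:R * (x + y) = n%:R * (m%:R * x) + m%:R * (n%:R * y).
  by rewrite natrM; ring.
by apply: rpredD; apply: rpredM; rewrite // Aint_Cnat // natr_nat.
Qed.

Lemma int2M x y : int2 x -> int2 y -> int2 (x * y).
Proof.
move=> [m om Ax] [n on Ay]; exists (m * n)%N; first by rewrite oddM om.
have -> : (m * n)%:R * (x * y) = (m%:R * x) * (n%:R * y).
  by rewrite natrM; ring.
exact: rpredM.
Qed.

Lemma int2N x : int2 x -> int2 (- x).
Proof. by move=> [m om Ax]; exists m => //; rewrite mulrN rpredN. Qed.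

Lemma int2B x y : int2 x -> int2 y -> int2 (x - y).
Proof. by move=> Ox Oy; apply/int2D/int2N. Qed.

Lemma int2X x n : int2 x -> int2 (x ^+ n).
Proof.
by move=> Ox; elim: n => [|n IHn]; [exact: (int2_int 1) | rewrite exprS; exact: int2M].
Qed.

Lemma int2_odd (n : int) x : ~~ (2 %| n)%Z -> int2 (n%:~R * x) -> int2 x.
Proof.
move=> on [m om Ax]; exists (m * `|n|)%N.
  by rewrite oddM om /=; lia.
have -> : (m * `|n|)%:R * x = (sgz n)%:~R * (m%:R * (n%:~R * x)).
  have -> : (m * `|n|)%:R = m%:R * (`|n|%N%:Z)%:~R :> algC by rewrite natrM.
  by rewrite abszE -sgrz normrEsg intrM; ring.
by rewrite rpredM // Aint_int.
Qed.

(** An algebraic integer that is rational is an integer, so 1 / 2 is not 2-integral. *)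
Lemma int2_half (n : int) : int2 (n%:~R / 2) -> (2 %| n)%Z.
Proof.
move=> [m om Ax].
have /intrP[k Ek] : (m%:R * (n%:~R / 2) : algC) \is a Num.int.
  apply: Cint_rat_Aint => //; rewrite !rpredM ?rpredV //=; last exact: rpred_nat.
    exact: rpred_nat.
  exact: rpred_int.
have /intr_inj E : (m%:Z * n)%:~R = (k * 2)%:~R :> algC.
  by rewrite !intrM -Ek -[m%:~R]/(m%:R); field.
have : (2 %| m%:Z * n)%Z by rewrite E dvdz_mull.
by rewrite Gauss_dvdzr // /coprimez /= /gcdz /= eqz_nat -/(coprime 2 m) coprime2n.
Qed.

Lemma int2_ratr (q : rat) : int2 (ratr q) -> in_Z2 q.
Proof.
move=> [m om Am]; rewrite /in_Z2.
have /intrP[k Ek] : (m%:R * ratr q : algC) \is a Num.int.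
  by apply: Cint_rat_Aint => //; rewrite rpredM ?rpred_nat // Crat_rat.
have E : m%:R * q = k%:~R.
  by apply: (fmorph_inj (ratr : rat -> algC)); rewrite rmorphM /= ratr_int ratr_nat.
have Ez : m%:Z * numq q = k * denq q.
  by apply: (@intr_inj rat); rewrite !intrM -E numqE mulrA.
have : (denq q %| m%:Z * numq q)%Z by rewrite Ez dvdz_mull.
rewrite Gauss_dvdzl; last by rewrite coprimez_sym; exact: coprime_num_den.
by rewrite dvdzE /= => /dvdn_odd; apply.
Qed.

Lemma Z2_int2 (q : rat) : in_Z2 q -> int2 (ratr q).
Proof.
move=> oq; exists `|denq q|%N => //.
have -> : `|denq q|%:R * ratr q = (numq q)%:~R :> algC.
  rewrite -[`|denq q|%:R]/((`|denq q|%N : int)%:~R) absz_denq.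
  by rewrite -[in RHS](ratr_int algC) numqE rmorphM /= ratr_int mulrC.
exact: Aint_int.
Qed.

Definition even2 (x : algC) : Prop := int2 (x / 2).

Lemma even2D x y : even2 x -> even2 y -> even2 (x + y).
Proof. by rewrite /even2 mulrDl; exact: int2D. Qed.

Lemma even2B x y : even2 x -> even2 y -> even2 (x - y).
Proof. by rewrite /even2 mulrBl; exact: int2B. Qed.

Lemma even2Ml x y : int2 x -> even2 y -> even2 (x * y).
Proof. by rewrite /even2 -mulrA; exact: int2M. Qed.

Lemma even2_double x : int2 x -> even2 (2 * x).
Proof. by rewrite /even2 mulrAC divff ?pnatr_eq0 // mul1r. Qed.

Lemma even2_int (n : int) : (2 %| n)%Z -> even2 n%:~R.
Proof. by case/dvdzP => k ->; rewrite intrM mulrC; apply/even2_double/int2_int. Qed.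

Lemma even2_odd (n : int) x : ~~ (2 %| n)%Z -> even2 (n%:~R * x) -> even2 x.
Proof. by move=> on; rewrite /even2 -mulrA; exact: int2_odd. Qed.

Lemma odd_part (d : int) : d != 0 ->
  exists2 m : int, ~~ (2 %| m)%Z & d = m * 2 ^+ logn 2 `|d|.
Proof.
move=> d0.
have d_gt0 : (0 < `|d|)%N by rewrite absz_gt0.
have [m cm] := pfactor_coprime (isT : prime 2) d_gt0.
set l := logn _ _ => dE; exists (sgz d * m%:Z).
  by rewrite coprime2n in cm; move: cm d0; clear; case: sgzP => //; lia.
rewrite -mulrA {1}[d]intEsg dE PoszM; congr (_ * (_ * _)).
by rewrite -natz natrX.
Qed.

(** * Conjugates of a root of the quartic *)

Lemma horner_quartic (a b c s : int) :
  (quartic a b c).[s] = s ^+ 4 + a * s ^+ 2 + b * s + c.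
Proof. by rewrite /quartic !hornerE. Qed.

Lemma horner_deriv_quartic (a b c s : int) :
  (quartic a b c)^`().[s] = 4 * s ^+ 3 + 2 * a * s + b.
Proof. by rewrite /quartic !derivE !hornerE /=; ring. Qed.

Lemma map_quartic (a b c : int) :
  map_poly intr (quartic a b c)
  = 'X^4 + a%:~R *: 'X^2 + b%:~R *: 'X + (c%:~R)%:P :> {poly algC}.
Proof.
by rewrite /quartic !rmorphD /= !map_polyZ /= !map_polyXn map_polyX map_polyC.
Qed.

Lemma root_quartic (a b c : int) (x : algC) :
  root (map_poly intr (quartic a b c)) x ->
  x ^+ 4 + a%:~R * x ^+ 2 + b%:~R * x + c%:~R = 0.
Proof. by move/rootP; rewrite map_quartic !hornerE. Qed.

Lemma minCpoly_irreducible (f : {poly int}) (x : algC) (h : {poly rat}) :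
  irreducible_poly f -> root (map_poly intr f) x ->
  root (map_poly ratr h) x = (map_poly intr f %| h).
Proof.
move=> /irreducible_rat_int[_ irr] fx.
have [r [Er _] rP] := minCpolyP x.
have fr : r %| map_poly intr f.
  rewrite -rP -map_poly_comp /=.
  by rewrite (eq_map_poly (g := intr)) // => n /=; rewrite ratr_int.
rewrite rP; apply: eqp_dvdl; apply: irr => //.
apply: contraTneq (root_minCpoly x) => sr; rewrite Er.
have /size_poly1P[k k0 ->] : size r == 1 by apply/eqP.
by rewrite map_polyC rootC fmorph_eq0.
Qed.

(** A monic integral equation of m g(x) is also one of m g(y): the polynomial
    obtained by substitution is divisible by the minimal polynomial f of x, hence
    vanishes at y. This replaces the norm and trace of K. *)
Lemma int2_conj (f : {poly int}) (x y : algC) (g : {poly rat}) :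
  irreducible_poly f -> root (map_poly intr f) x -> root (map_poly intr f) y ->
  int2 (map_poly ratr g).[x] -> int2 (map_poly ratr g).[y].
Proof.
move=> irr fx fy [m om Az]; exists m => //.
set z := m%:R * _ in Az.
have [p [Ep _] _] := minCpolyP z.
pose h := p \Po (m%:R *: g).
have hE w : (map_poly ratr h).[w] = (minCpoly z).[m%:R * (map_poly ratr g).[w]].
  by rewrite map_comp_poly horner_comp map_polyZ /= hornerZ ratr_nat Ep.
have : root (map_poly ratr h) x.
  by rewrite rootE hE; exact: root_minCpoly.
rewrite (minCpoly_irreducible f x h irr fx) -(minCpoly_irreducible f y h irr fy) => hy.
apply: (@root_monic_Aint (minCpoly z)); last by [].
  by rewrite rootE -hE.
exact: minCpoly_monic.
Qed.

Lemma quartic_roots (a b c : int) :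
  exists x1 x2 x3 x4 : algC,
  [/\ {in [:: x1; x2; x3; x4], forall x, root (map_poly intr (quartic a b c)) x},
      x1 + x2 + x3 + x4 = 0,
      x1 * x2 + x1 * x3 + x1 * x4 + x2 * x3 + x2 * x4 + x3 * x4 = a%:~R,
      x1 * x2 * x3 + x1 * x2 * x4 + x1 * x3 * x4 + x2 * x3 * x4 = - b%:~R
    & x1 * x2 * x3 * x4 = c%:~R].
Proof.
set f : {poly algC} := map_poly _ _.
have coef_f k : f`_k = [:: c%:~R; b%:~R; a%:~R; 0; 1]`_k.
  rewrite /f map_quartic !coefE.
  by case: k => [|[|[|[|[|k]]]]] /=; rewrite ?nth_nil; ring.
have sf : size f = 5.
  apply/eqP; rewrite eqn_leq; apply/andP; split.
    by apply/leq_sizeP => -[|[|[|[|[|k]]]]] // _; rewrite coef_f /= nth_nil.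
  by rewrite leqNgt; apply/negP => /leq_sizeP/(_ 4 isT)/eqP; rewrite coef_f oner_eq0.
have [rs] := closed_field_poly_normal f.
rewrite lead_coefE sf coef_f scale1r => Ef.
have : size rs = 4 by move: sf; rewrite Ef size_prod_XsubC => -[].
have rsf : {in rs, forall x, root f x} by move=> x; rewrite Ef root_prod_XsubC.
case: rs Ef rsf => [|x1 [|x2 [|x3 [|x4 []]]]] // Ef rsf _.
exists x1, x2, x3, x4.
set e1 := x1 + _ + _ + _; set e2 := _ + _ + _ + _ + _ + _.
set e3 := _ + _ + _ + _; set e4 := x1 * _ * _ * _.
have Ee : f = 'X^4 - e1%:P * 'X^3 + e2%:P * 'X^2 - e3%:P * 'X + e4%:P.
  by rewrite Ef !big_cons big_nil /e1 /e2 /e3 /e4; ring.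
have coefs k : f`_k = [:: e4; - e3; e2; - e1; 1]`_k.
  by rewrite Ee !coefE; case: k => [|[|[|[|[|k]]]]] /=; rewrite ?nth_nil; ring.
split=> //.
- by have := coefs 3%N; rewrite coef_f /= => /eqP; rewrite eq_sym oppr_eq0 => /eqP.
- by have := coefs 2%N; rewrite coef_f.
- by have := coefs 1%N; rewrite coef_f /= => ->; rewrite opprK.
- by have := coefs 0%N; rewrite coef_f.
Qed.

(** * Norm and trace obstructions *)

Lemma map_ratr_int (n : int) : map_poly ratr (n%:~R)%:P = (n%:~R)%:P :> {poly algC}.
Proof. by rewrite map_polyC; congr (_%:P); exact: ratr_int. Qed.

Lemma map_ratr_half (N : nat) : map_poly ratr (2 ^- N)%:P = (2 ^- N)%:P :> {poly algC}.
Proof.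
rewrite map_polyC; congr (_%:P); rewrite /= fmorphV rmorphXn; congr (_ ^- _).
exact: ratr_nat.
Qed.

(** If w = (t^2 + 1) / 2 were 2-integral for t = x - s, then so would be its
    conjugates w_i, and f(s)^2 = prod t_i^2 = prod (2 w_i - 1) would be odd. *)
Lemma not_even2_sqr1 (a b c s : int) (x : algC) :
  irreducible_poly (quartic a b c) -> root (map_poly intr (quartic a b c)) x ->
  (2 %| (quartic a b c).[s])%Z -> ~ even2 ((x - s%:~R) ^+ 2 + 1).
Proof.
rewrite /even2 => irr fx ev Ox.
have [x1 [x2 [x3 [x4 [fxi e1 e2 e3 e4]]]]] := quartic_roots a b c.
pose g : {poly rat} := (('X - s%:~R%:P) ^+ 2 + 1) * (2 ^- 1)%:P.
have gE y : (map_poly ratr g).[y] = ((y - s%:~R) ^+ 2 + 1) / 2 :> algC.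
  rewrite !(rmorphM, rmorphB, rmorphD, rmorphXn, rmorph1) /= (map_ratr_half 1) map_ratr_int map_polyX.
  by rewrite !hornerE.
have Oi y : y \in [:: x1; x2; x3; x4] -> int2 (((y - s%:~R) ^+ 2 + 1) / 2).
  by move=> /fxi fy; rewrite -gE; apply: (int2_conj _ x y g irr fx fy); rewrite gE.
set w := fun y : algC => ((y - s%:~R) ^+ 2 + 1) / 2 in Oi.
have wE y : 2 * w y - 1 = (y - s%:~R) ^+ 2 by rewrite /w; field.
pose u := 2 * w x1 * w x2 - w x1 - w x2.
pose v := 2 * w x3 * w x4 - w x3 - w x4.
have O2 := int2_int 2.
have O1 : int2 (w x1) by apply: Oi; rewrite !inE eqxx.
have O2' : int2 (w x2) by apply: Oi; rewrite !inE eqxx ?orbT.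
have O3 : int2 (w x3) by apply: Oi; rewrite !inE eqxx ?orbT.
have O4 : int2 (w x4) by apply: Oi; rewrite !inE eqxx ?orbT.
have Ou : int2 u by do 2!apply: int2B => //; do 2!apply: int2M => //.
have Ov : int2 v by do 2!apply: int2B => //; do 2!apply: int2M => //.
have : int2 (((quartic a b c).[s] ^+ 2 - 1)%:~R / 2).
  have -> : ((quartic a b c).[s] ^+ 2 - 1)%:~R / 2 = u + v + 2 * u * v.
    have fs : (quartic a b c).[s]%:~R
        = (x1 - s%:~R) * (x2 - s%:~R) * (x3 - s%:~R) * (x4 - s%:~R).
      rewrite horner_quartic !(intrD, intrM, rmorphXn) /= -e2 -e4.
      have -> : b%:~R = - (- b%:~R) :> algC by rewrite opprK.
      rewrite -e3.
      have -> : x4 = - (x1 + x2 + x3) by apply/eqP; rewrite -subr_eq0 opprK addrC e1.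
      ring.
    have -> : ((quartic a b c).[s] ^+ 2 - 1)%:~R = (2 * w x1 - 1) * (2 * w x2 - 1) *
       ((2 * w x3 - 1) * (2 * w x4 - 1)) - 1.
      by rewrite !wE intrB rmorphXn /= fs; ring.
    by rewrite /u /v; field.
  by do 2?[apply: int2D => //]; do 2!apply: int2M => //.
by move/int2_half; move: ev; set n := _.[s] => ev; lia.
Qed.

(** The trace of alpha is f'(s), so that of alpha / 2^N is B, while the trace of
    (x - s)^2 + 1 is even; half of an even element has an integral trace. *)
Lemma even2_trace (a b c s p q B : int) (N : nat) (x : algC) :
  irreducible_poly (quartic a b c) -> root (map_poly intr (quartic a b c)) x ->
  (quartic a b c)^`().[s] = 2 ^+ N * B ->
  even2 (p%:~R * ((x - s%:~R) ^+ 2 + 1) + q%:~R * (alpha a b s x / 2 ^+ N)) ->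
  (2 %| q * B)%Z.
Proof.
rewrite /even2 => irr fx fB Ox.
have [x1 [x2 [x3 [x4 [fxi e1 e2 e3 e4]]]]] := quartic_roots a b c.
pose h : {poly rat} := 'X^3 + s%:~R%:P * 'X^2 + (a + s ^+ 2)%:~R%:P * 'X
  + (s ^+ 3 + a * s + b)%:~R%:P.
pose g : {poly rat} := (p%:~R%:P * (('X - s%:~R%:P) ^+ 2 + 1)
  + q%:~R%:P * (h * (2 ^- N)%:P)) * (2 ^- 1)%:P.
set G := fun y : algC =>
  (p%:~R * ((y - s%:~R) ^+ 2 + 1) + q%:~R * (alpha a b s y / 2 ^+ N)) / 2.
have gE y : (map_poly ratr g).[y] = G y.
  rewrite !(rmorphM, rmorphB, rmorphD, rmorphXn, rmorph1) /= !map_ratr_half !map_ratr_int.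
  by rewrite map_polyX !(hornerM, hornerD, hornerN, hornerX, hornerC, horner_exp) /G /alpha; ring.
have Oi y : y \in [:: x1; x2; x3; x4] -> int2 (G y).
  by move=> /fxi fy; rewrite -gE; apply: (int2_conj _ x y g irr fx fy); rewrite gE.
have O : int2 (G x1 + G x2 + G x3 + G x4).
  by apply: int2D; [apply: int2D; [apply: int2D|]|]; apply: Oi; rewrite !inE eqxx ?orbT.
have n2 : (2 : algC) ^+ N != 0 by rewrite expf_neq0 // pnatr_eq0.
have tr : G x1 + G x2 + G x3 + G x4
  = (p * (2 * s ^+ 2 - a + 2))%:~R + (q * B)%:~R / 2.
  have : (2 ^+ N * B)%:~R = (4 * s ^+ 3 + 2 * a * s + b)%:~R :> algC.
    by rewrite -fB horner_deriv_quartic.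
  rewrite !intrM rmorphXn /= => EB.
  have -> : B%:~R = (4 * s ^+ 3 + 2 * a * s + b)%:~R / 2 ^+ N :> algC.
    by rewrite -EB mulrC mulKf.
  rewrite /G /alpha !(intrD, intrM, intrB, rmorphXn, rmorphN) /= -e2.
  have -> : b%:~R = - (- b%:~R) :> algC by rewrite opprK.
  rewrite -e3.
  have -> : x4 = - (x1 + x2 + x3) by apply/eqP; rewrite -subr_eq0 opprK addrC e1.
  by field.
apply: int2_half.
have -> : (q * B)%:~R / 2 = G x1 + G x2 + G x3 + G x4 - (p * (2 * s ^+ 2 - a + 2))%:~R.
  by rewrite tr [RHS]addrC addKr.
by apply: int2B => //; apply: int2_int.
Qed.

(** The element alpha is the quotient (f(x) - f(s)) / (x - s) at a root x of f. *)
Lemma alphaM (a b c s : int) (x : algC) :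
  root (map_poly intr (quartic a b c)) x ->
  (x - s%:~R) * alpha a b s x = - ((quartic a b c).[s])%:~R.
Proof.
move/root_quartic => fx; rewrite horner_quartic /alpha !(intrD, intrM, rmorphXn) /=.
by apply/eqP; rewrite -subr_eq0 opprK; apply/eqP; rewrite -[RHS]fx; ring.
Qed.

Lemma alphaE (a b c s : int) (x : algC) :
  alpha a b s x = (x - s%:~R) ^+ 3 + 4 * s%:~R * (x - s%:~R) ^+ 2
    + (6 * s ^+ 2 + a)%:~R * (x - s%:~R) + ((quartic a b c)^`().[s])%:~R.
Proof.
by rewrite horner_deriv_quartic /alpha !(intrD, intrM, rmorphXn) /=; ring.
Qed.

(** * The element alpha at a place *)

(** With A_i the Taylor coefficients of f at s, the substitution x - s = 2^N Y
    turns the part A_2 (x - s)^2 + A_1 (x - s) + A_0 of the expansion into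
    4^N (A_2 Y^2 + B1 Y + B0), where A_2 = 6 s^2 + a. For odd a the condition says
    that this quadratic polynomial is separable modulo 2 or of Eisenstein type at 2;
    by Dedekind's criterion its order is then maximal at 2. *)
Definition maximal_at (a b c s : int) (N : nat) (B0 B1 : int) : Prop :=
  [/\ (quartic a b c).[s] = 4 ^+ N * B0, (quartic a b c)^`().[s] = 2 ^+ N * B1
    & ~~ (2 %| B1)%Z \/ (2 %| B1)%Z /\ ~~ (4 %| B0)%Z /\ (2 %| B0)%Z].

Lemma even_quartic (a b c s : int) :
  ~~ (2 %| a)%Z -> (2 %| b)%Z -> (2 %| c)%Z -> (2 %| (quartic a b c).[s])%Z.
Proof.
rewrite horner_quartic => ao /dvdzP[b' ->] /dvdzP[c' ->].
have [a' ->] : exists a', a = a' * 2 + 1 by exists (a %/ 2)%Z; lia.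
have [s' [->|->]] : exists s', s = s' * 2 \/ s = s' * 2 + 1.
    by exists (s %/ 2)%Z; lia.
  apply/dvdzP; exists (8 * s' ^+ 4 + (a' * 2 + 1) * 2 * s' ^+ 2 + b' * 2 * s' + c').
  by ring.
apply/dvdzP; exists (8 * s' ^+ 4 + 16 * s' ^+ 3 + 12 * s' ^+ 2 + 4 * s' + 1
  + (a' * 2 + 1) * (2 * s' ^+ 2 + 2 * s') + a' + b' * (s' * 2 + 1) + c').
by ring.
Qed.

Lemma even_deriv_quartic (a b c s : int) :
  (2 %| b)%Z -> (2 %| (quartic a b c)^`().[s])%Z.
Proof.
rewrite horner_deriv_quartic => /dvdzP[b' ->]; apply/dvdzP.
by exists (2 * s ^+ 3 + a * s + b'); ring.
Qed.

Lemma size_quartic (a b c : int) : size (quartic a b c) = 5.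
Proof.
rewrite /quartic -!addrA size_polyDl size_polyXn // ltnS.
do ![apply: (leq_trans (size_polyD _ _)); rewrite geq_max; apply/andP; split];
  rewrite ?(leq_trans (size_scale_leq _ _)) ?size_polyXn ?size_polyX //.
exact: leq_trans (size_polyC_leq1 _) _.
Qed.

Lemma monic_quartic (a b c : int) : quartic a b c \is monic.
Proof.
by rewrite monicE lead_coefE size_quartic /quartic !coefE /= !mulr0 !addr0.
Qed.

Lemma int2_root (x : algC) (a b c s : int) :
  root (map_poly intr (quartic a b c)) x -> int2 (x - s%:~R).
Proof.
move=> fx; apply: int2B (int2_int _); apply: int2_Aint.
apply: (root_monic_Aint fx); first exact/monic_map/monic_quartic.
by apply/polyOverP => i; rewrite coef_map intr_int.
Qed.

(** With A_2 = 6 s^2 + a, the element alpha / 2^N is a root of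
    X^4 - B1 X^3 + A_2 B0 X^2 - 4 s B0^2 2^N X + B0^3 4^N. *)
Lemma int2_alpha (a b c s : int) (N : nat) (B0 B1 : int) (x : algC) :
  root (map_poly intr (quartic a b c)) x ->
  (quartic a b c).[s] = 4 ^+ N * B0 -> (quartic a b c)^`().[s] = 2 ^+ N * B1 ->
  int2 (alpha a b s x / 2 ^+ N).
Proof.
move=> fx E0 E1; apply: int2_Aint.
set y := _ / _.
have n2 : (2 : algC) ^+ N != 0 by rewrite expf_neq0 // pnatr_eq0.
pose P : {poly int} := 'X^4 + (- B1 *: 'X^3 + ((6 * s ^+ 2 + a) * B0 *: 'X^2 +
   (- (4 * s * B0 ^+ 2 * 2 ^+ N) *: 'X + (B0 ^+ 3 * 4 ^+ N)%:P))).
have PE : map_poly intr P = 'X^4 + (- B1)%:~R *: 'X^3 + ((6 * s ^+ 2 + a) * B0)%:~R *: 'X^2 +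
   (- (4 * s * B0 ^+ 2 * 2 ^+ N))%:~R *: 'X + (B0 ^+ 3 * 4 ^+ N)%:~R%:P :> {poly algC}.
  by rewrite /P !rmorphD /= !map_polyZ /= !map_polyXn map_polyX map_polyC /= !addrA.
have sP : size P = 5.
  rewrite /P size_polyDl size_polyXn // ltnS.
  do ![apply: (leq_trans (size_polyD _ _)); rewrite geq_max; apply/andP; split];
   rewrite ?(leq_trans (size_scale_leq _ _)) ?size_polyXn ?size_polyX //.
  exact: leq_trans (size_polyC_leq1 _) _.
apply: (@root_monic_Aint (map_poly intr P)).
- rewrite rootE PE !(hornerD, hornerZ, hornerX, hornerXn, hornerC).
  have yE : alpha a b s x = 2 ^+ N * y by rewrite /y mulrC divfK.
  have tE : (x - s%:~R) * alpha a b s x = - (4 ^+ N * B0%:~R).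
    by rewrite (alphaM _ _ c) // E0 intrM rmorphXn.
  have aE := alphaE a b c s x.
  rewrite E1 intrM rmorphXn /= in aE.
  have e4 : 4 ^+ N = 2 ^+ N * 2 ^+ N :> algC by rewrite -exprMn -natrM.
  rewrite e4 in tE.
  rewrite !(intrM, rmorphXn, rmorphN, intrD) /= !intrM !rmorphXn /= e4.
  rewrite yE in aE tE; rewrite intrD intrM rmorphXn /= in aE; move: aE tE n2.
  set t := x - _; set d := 2 ^+ N => aE tE d0.
  (* The relation t alpha = - f(s), divided by d = 2^N. *)
  have dB : d * B0%:~R = - (t * y).
    by apply: (mulfI d0); rewrite mulrA -[RHS]opprK -mulrN opprK mulrCA tE opprK.
  apply/eqP; apply: (mulfI d0); rewrite mulr0.
  transitivity (d * y ^+ 4 - d * B1%:~R * y ^+ 3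
    + (6 * s%:~R ^+ 2 + a%:~R) * (d * B0%:~R) * y ^+ 2
    - 4 * s%:~R * (d * B0%:~R) ^+ 2 * y + (d * B0%:~R) ^+ 3); first by ring.
  rewrite dB.
  transitivity (y ^+ 3 * (d * y - (t ^+ 3 + 4 * s%:~R * t ^+ 2 + (6 * s%:~R ^+ 2 + a%:~R) * t
    + d * B1%:~R))); first by ring.
  by rewrite -aE subrr mulr0.
- by rewrite monic_map // monicE lead_coefE sP /P !coefE /= !mulr0 !addr0.
- by apply/polyOverP => i; rewrite coef_map intr_int.
Qed.

Section Local.

Variables (a b c : int) (x : algC).
Hypothesis f_irr : irreducible_poly (quartic a b c).
Hypothesis a_odd : ~~ (2 %| a)%Z.
Hypothesis b_even : (2 %| b)%Z.
Hypothesis c_even : (2 %| c)%Z.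
Hypothesis f_x : root (map_poly intr (quartic a b c)) x.

Variables (s : int) (N : nat) (B0 B1 : int).
Hypothesis f_s : maximal_at a b c s N B0 B1.

Let t := x - s%:~R.
Let y := alpha a b s x / 2 ^+ N.

Lemma int2_scaled_alpha : int2 y.
Proof. by have [E0 E1 _] := f_s; exact: int2_alpha E0 E1. Qed.

Lemma mul_root_scaled_alpha : t * y = - (2 ^+ N * B0)%:~R.
Proof.
have [E0 _ _] := f_s.
have n2 : (2 : algC) ^+ N != 0 by rewrite expf_neq0 // pnatr_eq0.
rewrite /t /y mulrA (alphaM _ _ c) // E0 !intrM !rmorphXn /=.
have -> : 4%:~R ^+ N = 2 ^+ N * 2 ^+ N :> algC by rewrite -exprMn -natrM.
by field.
Qed.

(** Multiply 2^N y = t^3 + 4 s t^2 + A_2 t + 2^N B1 by y and use t y = - 2^N B0. *)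
Lemma sqr_scaled_alpha :
  y ^+ 2 = B1%:~R * y - B0%:~R * (t ^+ 2 + 4 * s%:~R * t + (6 * s ^+ 2 + a)%:~R).
Proof.
have [_ E1 _] := f_s.
have n2 : (2 : algC) ^+ N != 0 by rewrite expf_neq0 // pnatr_eq0.
have yE : 2 ^+ N * y = t ^+ 3 + 4 * s%:~R * t ^+ 2 + (6 * s ^+ 2 + a)%:~R * t + 2 ^+ N * B1%:~R.
  rewrite /y mulrC divfK // (alphaE _ _ c) -/t E1.
  by rewrite intrM rmorphXn.
apply: (mulfI n2).
transitivity (y * (2 ^+ N * y)); first by ring.
rewrite yE.
transitivity ((t * y) * (t ^+ 2 + 4 * s%:~R * t + (6 * s ^+ 2 + a)%:~R) + 2 ^+ N * B1%:~R * y).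
  by ring.
by rewrite mul_root_scaled_alpha intrM rmorphXn /=; ring.
Qed.

(** If N = 0 then B1 is even, which forces B0 to be even. *)
Lemma even2_mul_root_scaled_alpha : even2 (t * y).
Proof.
rewrite mul_root_scaled_alpha -rmorphN; apply: even2_int; rewrite rpredN.
have [_ E1 B] := f_s.
have [N0|Npos] := posnP N; last first.
  by rewrite dvdz_mulr // -(prednK Npos) exprS dvdz_mulr.
rewrite N0 mul1r; case: B => [oB1|[_ []//]].
have := even_deriv_quartic a b c s b_even.
by rewrite E1 N0 mul1r (negPf oB1).
Qed.

(** Modulo 2 the element t^2 + 1 is the idempotent of the place of s, so this says
    that 1 and y are independent modulo 2 there. If B1 is odd, the trace shows that
    q is even. If B1 is even, then y^2 and y (t^2 + 1) - y are even, so multiplying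
    by y leaves p y even; this reduces everything to y / 2 not being 2-integral. As
    B0 is 2 modulo 4, the square of y / 2 would make (t^2 + 1) / 2 2-integral. *)
Lemma local_independence (p q : int) :
  even2 (p%:~R * (t ^+ 2 + 1) + q%:~R * y) -> (2 %| p)%Z /\ (2 %| q)%Z.
Proof.
move=> Epq; have [E0 E1 B] := f_s.
have Ot : int2 t by exact: int2_root f_x.
have Oy := int2_scaled_alpha.
have even_fs := even_quartic a b c s a_odd b_even c_even.
have Oint := int2_int.
have p_even : even2 (p%:~R * (t ^+ 2 + 1)) -> (2 %| p)%Z.
  move=> Ep; apply: contraT => op; case: (not_even2_sqr1 a b c s x f_irr f_x even_fs).
  exact: even2_odd op Ep.
case: B => [oB1|[eB1 [oB0 eB0]]].
  have := even2_trace a b c s p q B1 N x f_irr f_x E1 Epq.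
  rewrite Gauss_dvdzl => [eq|]; last first.
    by rewrite /coprimez /gcdz /= eqz_nat -/(coprime 2 _) coprime2n; lia.
  split=> //; apply: p_even.
  have -> : p%:~R * (t ^+ 2 + 1) = p%:~R * (t ^+ 2 + 1) + q%:~R * y - y * q%:~R by ring.
  by apply: even2B => //; apply: even2Ml => //; apply: even2_int.
have Ey : even2 y -> False.
  move=> E; case: (not_even2_sqr1 a b c s x f_irr f_x even_fs).
  have [k B0E] : exists k, B0 = 2 * k by exists (B0 %/ 2)%Z; lia.
  have ok : ~~ (2 %| k)%Z by move: oB0; rewrite B0E; lia.
  have [l B1E] : exists l, B1 = 2 * l by exists (B1 %/ 2)%Z; lia.
  have [m aE] : exists m, a = 2 * m + 1 by exists (a %/ 2)%Z; lia.
  apply: (even2_odd k) => //.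
  have -> : k%:~R * (t ^+ 2 + 1) = l%:~R * y - y / 2 * y
     - 2 * (k%:~R * (2 * s%:~R * t + (3 * s ^+ 2 + m)%:~R)) .
    have -> : y / 2 * y = y ^+ 2 / 2 by field.
    by rewrite sqr_scaled_alpha B0E B1E aE !(intrD, intrM, rmorphXn) /=; field.
  apply: even2B; last first.
    apply: even2_double; apply: int2M => //; apply: int2D => //.
    by apply: int2M => //; apply: int2M => //; exact: (Oint 2).
  by apply: even2B; apply: even2Ml.
have Epy : even2 (p%:~R * y).
  have -> : p%:~R * y = y * (p%:~R * (t ^+ 2 + 1) + q%:~R * y)
    - (p%:~R * t) * (t * y) - q%:~R * y ^+ 2 by ring.
  apply: even2B; first by apply: even2B; apply: even2Ml => //;
     [exact: int2M | exact: even2_mul_root_scaled_alpha].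
  apply: even2Ml => //; rewrite sqr_scaled_alpha; apply: even2B.
    by rewrite mulrC; apply: even2Ml => //; apply: even2_int.
  rewrite mulrC; apply: even2Ml; last exact: even2_int.
  apply: int2D => //; apply: int2D; first exact: int2X.
  by do 2!apply: int2M => //; exact: (Oint 4).
have ep : (2 %| p)%Z by apply: contraT => op; case: Ey; exact: even2_odd Epy.
split=> //; apply: contraT => oq; case: Ey; apply: even2_odd oq _.
have -> : q%:~R * y = p%:~R * (t ^+ 2 + 1) + q%:~R * y - (t ^+ 2 + 1) * p%:~R by ring.
apply: even2B => //; apply: even2Ml; last exact: even2_int.
by apply: int2D; [exact: int2X | exact: (Oint 1)].
Qed.

End Local.

(** * Rational combinations and the field generated by a root *)

Section Span.

Variables (P : rat -> Prop) (n : nat) (w : 'I_n -> algC).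
Hypotheses (P0 : P 0) (P1 : P 1) (PD : forall q r, P q -> P r -> P (q + r))
  (PM : forall q r, P q -> P r -> P (q * r)).

(** The predicate P is meant to be in_Z2 or the whole of rat. *)
Definition lspan (x : algC) : Prop :=
  exists q : 'I_n -> rat, (forall i, P (q i)) /\ x = \sum_(i < n) ratr (q i) * w i.

Lemma lspanD x y : lspan x -> lspan y -> lspan (x + y).
Proof.
move=> [q [Pq ->]] [r [Pr ->]]; exists (fun i => q i + r i).
split=> [i|]; first exact: PD.
by rewrite -big_split; apply: eq_bigr => i _ /=; rewrite rmorphD mulrDl.
Qed.

Lemma lspanZ k x : P k -> lspan x -> lspan (ratr k * x).
Proof.
move=> Pk [q [Pq ->]]; exists (fun i => k * q i).
split=> [i|]; first exact: PM.
by rewrite mulr_sumr; apply: eq_bigr => i _ /=; rewrite rmorphM mulrA.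
Qed.

Lemma lspan_gen i : lspan (w i).
Proof.
exists (fun j => (j == i)%:R); split=> [j|]; first by case: eqP.
rewrite (bigD1 i) //= eqxx rmorph1 mul1r big1 ?addr0 // => j /negPf->.
by rewrite rmorph0 mul0r.
Qed.

Lemma lspan0 : lspan 0.
Proof.
exists (fun=> 0); split=> //.
by rewrite big1 // => i _; rewrite rmorph0 mul0r.
Qed.

Lemma lspan_trans m (v : 'I_m -> algC) (q : 'I_m -> rat) :
  (forall i, P (q i)) -> (forall i, lspan (v i)) ->
  lspan (\sum_(i < m) ratr (q i) * v i).
Proof.
move=> Pq Pv; elim/big_rec: _ => [|i x _ Px]; first exact: lspan0.
by apply: lspanD => //; apply: lspanZ.
Qed.

End Span.

Lemma in_Z2P (q : rat) : in_Z2 q <-> int2 (ratr q).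
Proof. by split; [exact: Z2_int2 | exact: int2_ratr]. Qed.

Lemma in_Z2_int (n : int) : in_Z2 n%:~R.
Proof. by rewrite in_Z2P ratr_int; exact: int2_int. Qed.

Lemma in_Z2D q r : in_Z2 q -> in_Z2 r -> in_Z2 (q + r).
Proof. by rewrite !in_Z2P rmorphD; exact: int2D. Qed.

Lemma in_Z2M q r : in_Z2 q -> in_Z2 r -> in_Z2 (q * r).
Proof. by rewrite !in_Z2P rmorphM; exact: int2M. Qed.

Lemma in_2_integersE (theta x : algC) :
  in_2_integers theta x <-> in_Qadjoin theta x /\ int2 x.
Proof.
have scale (k : rat) z : in_Qadjoin theta z -> in_Qadjoin theta (ratr k * z).
  move=> [g [h [h0 ->]]]; exists (k *: g), h; split=> //.
  by rewrite map_polyZ /= hornerZ mulrA.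
split=> [[z [m [[Kz Az] om ->]]]|[Kx [m om Ax]]].
  have m0 : m%:R != 0 :> algC by rewrite pnatr_eq0; case: m om.
  split; last by exists m => //; rewrite mulrC divfK.
  have -> : z / m%:R = ratr (m%:R^-1) * z by rewrite fmorphV rmorph_nat mulrC.
  exact: scale.
exists (m%:R * x), m; split=> //; last first.
  by rewrite mulrAC divff ?mul1r // pnatr_eq0; case: (m) om.
by split=> //; rewrite -(ratr_nat algC m); exact: scale.
Qed.

Section Quartic.

Variables (a b c : int) (theta : algC).
Hypothesis f_irr : irreducible_poly (quartic a b c).
Hypothesis f_theta : root (map_poly intr (quartic a b c)) theta.

Let fQ : {poly rat} := map_poly intr (quartic a b c).

Lemma size_fQ : size fQ = 5.
Proof. by rewrite size_map_inj_poly ?size_quartic //; exact: intr_inj. Qed.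

Lemma fQ_theta : (map_poly ratr fQ).[theta] = 0.
Proof. by apply/rootP; rewrite (minCpoly_irreducible _ _ _ f_irr f_theta). Qed.

Lemma horner_cubic (q : 'I_4 -> rat) :
  (map_poly ratr (\poly_(i < 4) q (inord i))).[theta]
  = \sum_(i < 4) ratr (q i) * theta ^+ i.
Proof.
rewrite (@horner_coef_wide _ 4); last by rewrite (leq_trans (size_poly _ _)) ?size_poly.
by apply: eq_bigr => i _; rewrite coef_map coef_poly ltn_ord inord_val.
Qed.

Lemma Qadjoin_cubic x : in_Qadjoin theta x <->
  lspan (fun=> True) 4 (fun i => theta ^+ i) x.
Proof.
split=> [[g [h [h0 ->]]]|[q [_ ->]]]; last first.
  exists (\poly_(i < 4) q (inord i)), 1; rewrite rmorph1 hornerC oner_eq0 divr1.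
  by split=> //; rewrite horner_cubic.
have : coprimep fQ h.
  rewrite irreducible_poly_coprime; last exact/irreducible_rat_int.
  by rewrite -(minCpoly_irreducible _ _ _ f_irr f_theta).
case/Bezout_eq1_coprimepP => -[u v] /= Euv.
have Ehv : (map_poly ratr h).[theta] * (map_poly ratr v).[theta] = 1 :> algC.
  have := congr1 (fun p : {poly rat} => (map_poly ratr p : {poly algC}).[theta]) Euv.
  by rewrite rmorphD !rmorphM rmorph1 /= hornerC hornerD !hornerM fQ_theta mulr0 add0r mulrC.
pose r := (g * v) %% fQ.
have -> : (map_poly ratr g).[theta] / (map_poly ratr h).[theta] = (map_poly ratr r).[theta] :> algC.
  transitivity ((map_poly ratr (g * v)).[theta] : algC).
    rewrite rmorphM /= hornerM -[in RHS](mulfK h0 (map_poly ratr v).[theta]).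
    by rewrite (mulrC _.[theta] (map_poly ratr h).[theta]) Ehv mul1r.
  by rewrite (divp_eq (g * v) fQ) rmorphD rmorphM /= hornerD hornerM fQ_theta mulr0 add0r.
have sr : (size r <= 4)%N.
  have : (size r < size fQ)%N by rewrite ltn_modp -size_poly_eq0 size_fQ.
  by rewrite size_fQ.
exists (fun i => r`_i); split=> //.
rewrite (@horner_coef_wide _ 4); last by rewrite (leq_trans (size_poly _ _)).
by apply: eq_bigr => i _; rewrite coef_map.
Qed.

Lemma cubic_free (q : 'I_4 -> rat) :
  \sum_(i < 4) ratr (q i) * theta ^+ i = 0 -> forall i, q i = 0.
Proof.
rewrite -horner_cubic; move/rootP.
rewrite (minCpoly_irreducible _ _ _ f_irr f_theta) => dv i.
set p := \poly_(i < 4) _ in dv.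
have p0 : p = 0.
  apply: contraTeq dv => p0; apply/negP => /(dvdp_leq p0).
  by rewrite -/fQ size_fQ leqNgt ltnS size_poly.
have := congr1 (fun p : {poly rat} => p`_i) p0.
by rewrite coef_poly ltn_ord inord_val coef0.
Qed.

End Quartic.

(** * Separating the two places *)

Section Global.

Variables (a b c : int) (x : algC).
Hypothesis f_irr : irreducible_poly (quartic a b c).
Hypothesis a_odd : ~~ (2 %| a)%Z.
Hypothesis b_even : (2 %| b)%Z.
Hypothesis c_even : (2 %| c)%Z.
Hypothesis f_x : root (map_poly intr (quartic a b c)) x.
Variables (s : int) (N : nat) (B0 B1 : int).
Variables (N' : nat) (B0' B1' : int).
Hypothesis f_s : maximal_at a b c s N B0 B1.
Hypothesis f_s' : maximal_at a b c (s + 1) N' B0' B1'.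

Let t := x - s%:~R.
Let t' := x - (s + 1)%:~R.
Let y := alpha a b s x / 2 ^+ N.
Let y' := alpha a b (s + 1) x / 2 ^+ N'.

Lemma next_shiftE : t' = t - 1.
Proof. by rewrite /t' /t intrD opprD addrA. Qed.

(** Hence t^2 and t^2 + 1 are orthogonal idempotents modulo 2, belonging to the
    places of s + 1 and of s: this reflects f = x^2 (x + 1)^2 modulo 2. *)
Lemma even2_idem : even2 (t ^+ 4 + t ^+ 2).
Proof.
have Ot : int2 t by exact: int2_root f_x.
have [m aE] : exists m, a = 2 * m + 1 by exists (a %/ 2)%Z; lia.
have -> : t ^+ 4 + t ^+ 2 = (- (quartic a b c).[s])%:~R
   - t * ((quartic a b c)^`().[s])%:~R
   - 2 * (t ^+ 2 * (2 * s%:~R * t + (3 * s ^+ 2 + m)%:~R)).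
  rewrite intrN -(alphaM _ _ c _ _ f_x) (alphaE _ _ c) aE -/t !(intrD, intrM, rmorphXn) /=.
  by ring.
apply: even2B; first apply: even2B.
- by apply: even2_int; rewrite rpredN; exact: even_quartic.
- by apply: even2Ml => //; apply: even2_int; exact: even_deriv_quartic.
apply: even2_double; apply: int2M; first exact: int2X.
by apply: int2D; [do 2!apply: int2M => //; [exact: (int2_int 2)|exact: int2_int] | exact: int2_int].
Qed.

(** Multiplication by the idempotent t^2 + 1 (resp. t^2) kills modulo 2 the terms of
    the place of s + 1 (resp. of s) and leaves the relation of local_independence. *)
Lemma global_independence (p p' q q' : int) :
  even2 (p%:~R * (t ^+ 2 + 1) + p'%:~R * t ^+ 2 + q%:~R * y + q'%:~R * y') ->
  [/\ (2 %| p)%Z, (2 %| p')%Z, (2 %| q)%Z & (2 %| q')%Z].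
Proof.
set z := _ + _ => Ez.
have Oint := int2_int.
have Ot : int2 t by exact: int2_root f_x.
have Ot' : int2 t' by exact: int2_root f_x.
have Oy : int2 y by exact: int2_scaled_alpha f_s.
have Oy' : int2 y' by exact: int2_scaled_alpha f_s'.
have Ety : even2 (t * y) by exact: even2_mul_root_scaled_alpha f_s.
have Ety' : even2 (t' * y') by exact: even2_mul_root_scaled_alpha f_s'.
have Et2 := int2X _ 2 Ot.
have [ep eq] : (2 %| p)%Z /\ (2 %| q)%Z.
  apply: (local_independence a b c x f_irr a_odd b_even c_even f_x s N B0 B1 f_s).
  have -> : p%:~R * (t ^+ 2 + 1) + q%:~R * y = (t ^+ 2 + 1) * z
      - ((p + p')%:~R * (t ^+ 4 + t ^+ 2) + q%:~R * t * (t * y)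
         + q'%:~R * t' * (t' * y') + 2 * (q'%:~R * (t' + 1) * y')).
    by rewrite /z next_shiftE intrD; ring.
  apply: even2B.
    by apply: even2Ml => //; apply: int2D => //; exact: (Oint 1).
  apply: even2D; last first.
    by apply: even2_double; do 2!apply: int2M => //; apply: int2D => //; exact: (Oint 1).
  apply: even2D; [apply: even2D|].
  - by apply: even2Ml => //; exact: even2_idem.
  - by apply: even2Ml => //; apply: int2M.
  by apply: even2Ml => //; apply: int2M.
have [ep' eq'] : (2 %| p')%Z /\ (2 %| q')%Z.
  apply: (local_independence a b c x f_irr a_odd b_even c_even f_x (s + 1) N' B0' B1' f_s').
  have -> : p'%:~R * (t' ^+ 2 + 1) + q'%:~R * y' = t ^+ 2 * z
      - ((p + p')%:~R * (t ^+ 4 + t ^+ 2) + q%:~R * t * (t * y)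
         + q'%:~R * (t' + 2) * (t' * y')) + 2 * (p'%:~R * (t ^+ 2 - t + 1)).
    by rewrite /z next_shiftE intrD; ring.
  apply: even2D; last first.
    by apply: even2_double; apply: int2M => //; apply: int2D (Oint 1); exact: int2B.
  apply: even2B; first exact: even2Ml.
  apply: even2D; [apply: even2D|].
  - by apply: even2Ml => //; exact: even2_idem.
  - by apply: even2Ml => //; apply: int2M.
  by apply: even2Ml => //; apply: int2M => //; apply: int2D => //; exact: (Oint 2).
by [].
Qed.

(** A 2-integral basis of K adapted to the two places: modulo 2, t^2 + 1
    and y span the part of the place of s, and t^2 and y' that of s + 1. *)
Definition local_basis (i : 'I_4) : algC := [:: t ^+ 2 + 1; t ^+ 2; y; y']`_i.

Lemma local_basis_pow2 (k : nat) (m : 'I_4 -> int) :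
  int2 ((\sum_(i < 4) (m i)%:~R * local_basis i) / 2 ^+ k) ->
  forall i, (2 ^+ k %| m i)%Z.
Proof.
elim: k m => [|k IHk] m Om i; first by rewrite expr0 dvd1z.
have n2 : (2 : algC) ^+ k != 0 by rewrite expf_neq0 // pnatr_eq0.
have ev : forall i, (2 %| m i)%Z.
  have : even2 (\sum_(i < 4) (m i)%:~R * local_basis i).
    have := int2M _ _ (int2_int (2 ^+ k)) Om.
    rewrite exprSr invfM rmorphXn /= mulrCA [_ ^+ k * (_ / _)]mulrA divff // mul1r.
    by [].
  rewrite !big_ord_recl big_ord0 addr0 !addrA /=.
  move/global_independence => [e0 e1 e2 e3] [j lt_j].
  case: j lt_j => [|[|[|[|j]]]] // lt_j.
  - by rewrite (_ : Ordinal _ = ord0) //; exact/val_inj.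
  - by rewrite (_ : Ordinal _ = lift ord0 ord0) //; exact/val_inj.
  - by rewrite (_ : Ordinal _ = lift ord0 (lift ord0 ord0)) //; exact/val_inj.
  - by rewrite (_ : Ordinal _ = lift ord0 (lift ord0 (lift ord0 ord0))) //; exact/val_inj.
have mE j : m j = (m j %/ 2)%Z * 2 by rewrite divzK.
rewrite mE exprSr dvdz_mul2r //.
apply: (IHk (fun j => (m j %/ 2)%Z)).
congr int2: Om.
rewrite exprSr; set S := (X in _ = X / _).
have -> : \sum_(j < 4) (m j)%:~R * local_basis j = 2 * S.
  by rewrite /S mulr_sumr; apply: eq_bigr => j _; rewrite {1}mE intrM; ring.
by field.
Qed.

(** Over a common denominator m 2^k with m odd, the numerators are divisible by
    2^k. *)
Lemma local_basis_Z2 (r : 'I_4 -> rat) :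
  int2 (\sum_(i < 4) ratr (r i) * local_basis i) -> forall i, in_Z2 (r i).
Proof.
move=> Or i.
(* The numerators over a common denominator d are the coefficients of p. *)
have [p [d d0 Ep]] := rat_poly_scale (\poly_(i < 4) r (inord i)).
have rE j : r j = (p`_j)%:~R / d%:~R.
  have := congr1 (fun q : {poly rat} => q`_j) Ep.
  by rewrite coef_poly ltn_ord inord_val => ->; rewrite coefZ coef_map mulrC.
have [m om] := odd_part d d0; set k := logn _ _ => dE.
have n2 : (2 : algC) ^+ k != 0 by rewrite expf_neq0 // pnatr_eq0.
have m0 : m%:~R != 0 :> algC by rewrite intr_eq0; apply: contraNneq om => ->.
have : int2 ((\sum_(j < 4) (p`_j)%:~R * local_basis j) / 2 ^+ k).
  have := int2M _ _ (int2_int m) Or; congr int2.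
  rewrite mulr_sumr mulr_suml; apply: eq_bigr => j _.
  by rewrite rE fmorph_div !rmorph_int dE intrM rmorphXn /=; field; apply/andP.
move/local_basis_pow2/(_ i)/dvdzP => [l El].
rewrite in_Z2P; apply: (int2_odd m) => //.
have -> : m%:~R * ratr (r i) = l%:~R :> algC.
  rewrite rE fmorph_div !rmorph_int El dE !intrM rmorphXn /=; field; exact/andP.
exact: int2_int.
Qed.

End Global.

(** * From the local basis to triangular families *)

Lemma lspan4 (P : rat -> Prop) (w0 w1 w2 w3 x : algC) (r0 r1 r2 r3 : rat) :
  P r0 -> P r1 -> P r2 -> P r3 ->
  x = ratr r0 * w0 + ratr r1 * w1 + ratr r2 * w2 + ratr r3 * w3 ->
  lspan P 4 (tnth [tuple w0; w1; w2; w3]) x.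
Proof.
move=> P0 P1 P2 P3 ->; exists (fun i => [:: r0; r1; r2; r3]`_i); split.
  by case=> -[|[|[|[|i]]]].
by rewrite !big_ord_recl big_ord0 addr0 !addrA.
Qed.

Lemma lspan4_int (w0 w1 w2 w3 x : algC) (n0 n1 n2 n3 : int) :
  x = n0%:~R * w0 + n1%:~R * w1 + n2%:~R * w2 + n3%:~R * w3 ->
  lspan in_Z2 4 (tnth [tuple w0; w1; w2; w3]) x.
Proof.
move=> E; apply: (lspan4 _ _ _ _ _ _ n0%:~R n1%:~R n2%:~R n3%:~R);
  rewrite ?ratr_int //; exact: in_Z2_int.
Qed.

Section Basis.

Variables (a b c : int) (theta : algC).
Hypothesis f_irr : irreducible_poly (quartic a b c).
Hypothesis a_odd : ~~ (2 %| a)%Z.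
Hypothesis b_even : (2 %| b)%Z.
Hypothesis c_even : (2 %| c)%Z.
Hypothesis f_theta : root (map_poly intr (quartic a b c)) theta.
Variables (s : int) (N : nat) (B0 B1 : int).
Variables (N' : nat) (B0' B1' : int).
Hypothesis f_s : maximal_at a b c s N B0 B1.
Hypothesis f_s' : maximal_at a b c (s + 1) N' B0' B1'.

Let t := theta - s%:~R.
Let y := alpha a b s theta / 2 ^+ N.
Let y' := alpha a b (s + 1) theta / 2 ^+ N'.
Let G := local_basis a b theta s N N'.

Lemma alpha_diff : alpha a b (s + 1) theta = alpha a b s theta + theta ^+ 2
  + (2 * s + 1)%:~R * theta + (3 * s ^+ 2 + 3 * s + 1 + a)%:~R.
Proof. by rewrite /alpha !(intrD, intrM, rmorphXn) /=; ring. Qed.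

(** The difference of the alpha at s + 1 and at s is a quadratic polynomial in theta,
    which has 4 s + 1 as coefficient of theta once theta^2 is expressed by t^2 and
    theta: this solves for theta. *)
Lemma local_basis_span x : in_Qadjoin theta x -> lspan (fun=> True) 4 G x.
Proof.
move=> Kx.
have [q [_ ->]] := (Qadjoin_cubic a b c theta f_irr f_theta x).1 Kx.
pose S := lspan (fun=> True) 4 G.
have SD u v : S u -> S v -> S (u + v) by apply: lspanD.
have SZ (k : rat) u : S u -> S (ratr k * u) by apply: lspanZ.
have SI (k : int) u : S u -> S (k%:~R * u) by rewrite -ratr_int; apply: (SZ).
have SN u : S u -> S (- u) by move=> /(SI (-1)); rewrite mulN1r.
have S2 (k : nat) u : S u -> S (2 ^+ k * u).
  by move=> /(SI (2 ^+ k)); rewrite rmorphXn.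
have Sg i : S (G i) by apply: lspan_gen.
have Sg1 : S (t ^+ 2 + 1) by exact: (Sg 0).
have Sg2 : S (t ^+ 2) by exact: (Sg 1).
have Sy : S y by exact: (Sg 2).
have Sy' : S y' by exact: (Sg 3).
have n2 k : (2 : algC) ^+ k != 0 by rewrite expf_neq0 // pnatr_eq0.
have yE : alpha a b s theta = 2 ^+ N * y by rewrite mulrC divfK.
have y'E : alpha a b (s + 1) theta = 2 ^+ N' * y' by rewrite mulrC divfK.
have S1 : S 1.
  have -> : 1 = t ^+ 2 + 1 - t ^+ 2 by ring.
  by apply: (SD) => //; apply: (SN).
have St : S theta.
  have s0 : (4 * s + 1)%:~R != 0 :> algC by rewrite intr_eq0; apply/eqP; lia.
  have -> : theta = ratr (4 * s + 1)%:~R^-1 * (2 ^+ N' * y' - 2 ^+ N * y - t ^+ 2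
      + (- (2 * s ^+ 2 + 3 * s + 1 + a))%:~R * 1).
    rewrite -yE -y'E alpha_diff fmorphV rmorph_int; apply: (mulfI s0); rewrite mulVKf //.
    by rewrite /t !(rmorphN, intrD, intrM, rmorphXn) /= !(intrD, intrM, rmorphXn) /=; ring.
  by apply: (SZ); apply: (SD _ _ _ (SI _ _ S1)); apply: (SD); [apply: (SD); [|apply: (SN)]; apply: (S2) | apply: (SN)].
have St2 : S (theta ^+ 2).
  have -> : theta ^+ 2 = t ^+ 2 + (2 * s)%:~R * theta + (- s ^+ 2)%:~R * 1.
    by rewrite /t !(rmorphN, intrM, rmorphXn) /=; ring.
  by apply: (SD); [apply: (SD) => //|]; apply: (SI).
have St3 : S (theta ^+ 3).
  have -> : theta ^+ 3 = 2 ^+ N * y + (- s)%:~R * theta ^+ 2 + (- (a + s ^+ 2))%:~R * theta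
     + (- (s ^+ 3 + a * s + b))%:~R * 1.
    by rewrite -yE /alpha !(rmorphN, intrD, intrM, rmorphXn) /= ; ring.
  by apply: (SD); [apply: (SD); [apply: (SD); [exact: S2|]|]|]; apply: (SI).
apply: lspan_trans => // -[[|[|[|[|i]]]] lt_i] //; rewrite /= ?expr0 ?expr1 //.
Qed.

(** The local basis generates all 2-integral elements over Z_(2), so a free family
    of such elements that generates the local basis is a 2-integral basis. *)
Lemma basis_criterion (w : 4.-tuple algC) :
  (forall i, in_2_integers theta (tnth w i)) ->
  (forall i, lspan in_Z2 4 (tnth w) (G i)) ->
  (forall q : 'I_4 -> rat, \sum_(i < 4) ratr (q i) * tnth w i = 0 -> forall i, q i = 0) ->
  is_2_integral_basis theta w.
Proof.
move=> Ow Gw fw; split=> // [x /in_2_integersE[Kx Ox]|q _]; last exact: fw.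
have [r [_ Ex]] := local_basis_span _ Kx.
have Zr : forall i, in_Z2 (r i).
  apply: (local_basis_Z2 a b c theta f_irr a_odd b_even c_even f_theta
    s N B0 B1 N' B0' B1' f_s f_s').
  by rewrite -Ex.
by rewrite Ex; apply: (lspan_trans in_Z2 4 (tnth w) (in_Z2_int 0) in_Z2D in_Z2M).
Qed.

Lemma triangular_free (k m : nat) (e d0 d1 d2 : int) (q : 'I_4 -> rat) :
  \sum_(i < 4) ratr (q i) * tnth [tuple 1; theta; (theta ^+ 2 + e%:~R * theta) / 2 ^+ k;
    (theta ^+ 3 + d2%:~R * theta ^+ 2 + d1%:~R * theta + d0%:~R) / 2 ^+ m] i = 0 ->
  forall i, q i = 0.
Proof.
have n2 j : (2 : rat) ^+ j != 0 by rewrite expf_neq0 // pnatr_eq0.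
have n2C j : (2 : algC) ^+ j != 0 by rewrite expf_neq0 // pnatr_eq0.
have qE i : q i = [:: q 0; q 1; q 2; q 3]`_i.
  by case: i => -[|[|[|[|i]]]] // lt_i; congr (q _); apply: val_inj.
set q0 := q 0 in qE *; set q1 := q 1 in qE; set q2 := q 2 in qE; set q3 := q 3 in qE.
pose r2 := q2 / 2 ^+ k; pose r3 := q3 / 2 ^+ m.
pose r := [:: q0 + r3 * d0%:~R; q1 + r2 * e%:~R + r3 * d1%:~R; r2 + r3 * d2%:~R; r3].
move=> E.
have r0 : forall i : 'I_4, r`_i = 0.
  apply: (cubic_free a b c theta f_irr f_theta (fun i => r`_i)).
  rewrite -[RHS]E !big_ord_recl !big_ord0 /= !qE /= /r2 /r3.
  rewrite !(rmorphD, rmorphM) /= !fmorphV !rmorphXn !rmorph_nat /= !ratr_int.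
  by rewrite !(tnth_nth 0) /=; field; rewrite !n2C.
have e3 := r0 3; have e2 := r0 2; have e1 := r0 1; have e0 := r0 0.
rewrite /r /= in e0 e1 e2 e3.
rewrite e3 !mul0r !addr0 in e0 e1 e2; rewrite e2 mul0r addr0 in e1.
have q30 : q3 = 0 by move/eqP: e3; rewrite mulf_eq0 invr_eq0 (negPf (n2 _)) orbF => /eqP.
have q20 : q2 = 0 by move/eqP: e2; rewrite mulf_eq0 invr_eq0 (negPf (n2 _)) orbF => /eqP.
move=> i; rewrite qE e0 e1 q20 q30.
by case: i => -[|[|[|[|i]]]].
Qed.

End Basis.

(** * Regularity and the Newton polygon *)

Lemma odd_F2 (n : int) : ~~ (2 %| n)%Z -> n%:~R = 1 :> 'F_2.
Proof.
move=> on; have [k ->] : exists k, n = k * 2 + 1 by exists (n %/ 2)%Z; lia.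
rewrite intrD intrM (_ : 2%:~R = 0 :> 'F_2) ?mulr0 ?add0r //.
exact: val_inj.
Qed.

Section Newton.

Variables (a b c s : int).
Hypothesis a_odd : ~~ (2 %| a)%Z.
Let f := quartic a b c.

Lemma taylor_coefE : [/\ taylor_coef f s 0 = f.[s], taylor_coef f s 1 = f^`().[s]
  & taylor_coef f s 2 = 6 * s ^+ 2 + a].
Proof.
split; rewrite /taylor_coef ?nderivn0 ?nderivn1 //.
rewrite /f /quartic !nderivnD !nderivnZ -['X]expr1 !nderivnXn nderivnC /=.
by rewrite !hornerE /=; ring.
Qed.

Variable k : nat.
Hypothesis f_s0 : f.[s] != 0.
Hypothesis f_s : logn 2 `|f.[s]| = k.*2.
Hypothesis k_gt0 : (0 < k)%N.
Hypothesis f'_s : f^`().[s] != 0 -> (k < logn 2 `|f^`().[s]|)%N.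

Let h := height 2 f s.

Lemma taylor_coef2_odd : ~~ (2 %| taylor_coef f s 2)%Z.
Proof.
have [_ _ ->] := taylor_coefE.
by rewrite rpredDl //; apply/dvdzP; exists (3 * s ^+ 2); ring.
Qed.

Lemma height0 : h 0 = k.*2.
Proof. by rewrite /h /height; have [-> _ _] := taylor_coefE. Qed.

Lemma height2 : h 2 = 0%N.
Proof.
rewrite /h /height lognE /=; have := taylor_coef2_odd; rewrite dvdzE => /negPf.
by rewrite /= => ->; rewrite andbF.
Qed.

Lemma slope02 : slope 2 f s 0 2 = (- k%:Z)%:~R.
Proof.
rewrite /slope -/(h 0) -/(h 2) height0 height2 -muln2 natrM rmorphN /=.
by rewrite -[k%:~R]/(k%:R); field.
Qed.

(** The part of negative slope of the Newton polygon is here the single side from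
    (0, 2k) to (2, 0), and a point of abscissa 1, if any, is strictly above it. *)
Lemma chord02 j : chord 2 f s 0 2 j = (k%:R) * (2 - j%:R).
Proof.
rewrite /chord slope02 -/(h 0) height0 -muln2 natrM rmorphN /=.
by rewrite -[k%:~R]/(k%:R); ring.
Qed.

Lemma is_neg_side02 : is_neg_side 2 f s 0 2.
Proof.
have [T0 T1 T2] := taylor_coefE.
have k0 : 0 < k%:R :> rat by rewrite ltr0n.
apply/andP; split; last by rewrite slope02 ltrz0 oppr_lt0.
apply/and4P; split=> //; first by rewrite T0.
  by apply: contraNneq taylor_coef2_odd => ->.
apply/forallP => -[j lt_j]; apply/implyP => /= Tj; rewrite chord02 -/(h j).
case: j lt_j Tj => [|[|[|j]]] lt_j Tj.
- by rewrite height0 -muln2 natrM subr0 lexx implybT.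
- have : k%:R < (h 1)%:R :> rat.
    by rewrite ltr_nat /h /height T1; apply: f'_s; rewrite -T1.
  by move=> kh; rewrite (_ : 2 - 1%:R = 1) // mulr1 ltW //= implybT.
- by rewrite height2 subrr mulr0 lexx implybT.
have jh : k%:R * (2 - j.+3%:R) < (h j.+3)%:R :> rat.
  apply: lt_le_trans (ler0n _ _); rewrite pmulr_rlt0 // subr_lt0.
  by rewrite (ltr_nat _ 2).
by rewrite ltW //= lt_eqF.
Qed.

Lemma on_neg_polygon_end i : (i == 0) || (i == 2) -> on_neg_polygon 2 f s i.
Proof.
move=> i02; apply/andP; split.
  by have /andP[/and4P[_ n0 n2 _] _] := is_neg_side02; case/orP: i02 => /eqP->.
apply/existsP; exists (inord 0); apply/existsP; exists (inord 2).
rewrite !inordK // is_neg_side02 chord02 -/(h i).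
by case/orP: i02 => /eqP-> /=; rewrite ?height0 ?height2 -?muln2 ?natrM ?subr0 ?subrr ?mulr0 eqxx.
Qed.

(** A line below the points of abscissas 0 and 2 is at most k at abscissa 1. *)
Lemma on_neg_polygon1 : on_neg_polygon 2 f s 1 = false.
Proof.
have [T0 T1 T2] := taylor_coefE.
apply/negP => /andP[n1 /existsP[i /existsP[j /and3P[/andP[/and4P[_ _ _ /forallP side] _] _ /eqP]]]].
have /andP[n0 n2] : (taylor_coef f s 0 != 0) && (taylor_coef f s 2 != 0).
  by have /andP[/and4P[_ -> -> _] _] := is_neg_side02.
have := side (inord 0); have := side (inord 2).
rewrite !inordK // n0 n2 /= => /andP[+ _] /andP[+ _].
rewrite -/(h 0) -/(h 1) -/(h 2) height0 height2 /chord -muln2 natrM.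
have : k%:R < (h 1)%:R :> rat.
  by rewrite ltr_nat /h /height T1; apply: f'_s; rewrite -T1.
set S := slope _ _ _ _ _; set u := _%:R; set v := _%:R.
lra.
Qed.

(** The residual polynomial is y^2 + 1, whose derivative vanishes in characteristic
    2. *)
Lemma not_regular : ~ regular 2 f s.
Proof.
move=> /(_ (inord 0) (inord 2)); rewrite !inordK // => /(_ is_neg_side02).
set p := residual_poly _ _ _ _ _.
have pE i : p`_i = if (i < 3)%N then residual_coef 2 f s i else 0.
  by rewrite /p /residual_poly slope02 denq_int coef_poly muln1.
have rc i : (i == 0)%N || (i == 2)%N -> residual_coef 2 f s i = 1.
  move=> i02; rewrite /residual_coef on_neg_polygon_end //.
  apply: odd_F2.
  have : taylor_coef f s i != 0.
    by have /andP[/and4P[_ n0 n2 _] _] := is_neg_side02; case/orP: i02 => /eqP->.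
  rewrite /height; set A := taylor_coef _ _ _ => A0.
  have [m om AE] := odd_part A A0.
  rewrite {1}AE -[(2 ^ _)%N%:Z]natz natrX mulzK //; exact: expf_neq0.
have p'0 : p^`() = 0.
  apply/polyP => -[|[|i]]; rewrite coef_deriv coef0 pE ?mul0rn //=.
  - by rewrite /residual_coef on_neg_polygon1.
  by rewrite rc //; apply: val_inj.
move/separable_deriv_eq0/(_ (dvdpp p)); rewrite p'0 eqxx => sp.
have : (2 < size p)%N.
  by rewrite ltnNge; apply/negP => /leq_sizeP/(_ 2 isT); rewrite pE /= rc.
by move/ltnW/sp.
Qed.

End Newton.

Lemma horner_quartic_neq0 (a b c s : int) :
  irreducible_poly (quartic a b c) -> (quartic a b c).[s] != 0.
Proof.
move=> [_ irr]; apply/negP => fs.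
have /irr : size ('X - s%:P : {poly int}) != 1 by rewrite size_XsubC.
rewrite Pdiv.Idomain.dvdp_XsubCl => /(_ fs)/eqp_size.
by rewrite size_XsubC size_quartic.
Qed.

Lemma floor_half (n : nat) : Num.floor (n%:R / 2 : rat) = n./2%:Z.
Proof.
apply: floor_def; rewrite -{2 3}(odd_double_half n) -muln2 natrD natrM.
rewrite intrD -[n./2%:Z%:~R]/(n./2%:R).
by case: (odd n) => /=; apply/andP; split; lra.
Qed.

Lemma nuE (f : {poly int}) (s : int) : f.[s] != 0 ->
  nu f s = (if f^`().[s] == 0 then (logn 2 `|f.[s]|)./2
            else minn (logn 2 `|f.[s]|)./2 (logn 2 `|f^`().[s]|))%:Z.
Proof.
move=> fs0; rewrite /nu /valuation (negPf fs0) inver.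
have -> : (2%:R == 0 :> rat) = false by [].
rewrite -EFinM; case: eqP => [_|_]; first by rewrite miney /= floor_half.
rewrite -EFin_min /=.
set u := logn _ _; set v := logn _ _.
have [uv|vu] := leqP u./2 v.
  have [le_uv|lt_vu] := leP (u%:R / 2 : rat) v%:R.
    exact: floor_half.
  apply: floor_def; rewrite -[v%:R]/(v%:Z%:~R) ler_int ltr_int.
  move: lt_vu; rewrite ltr_pdivlMr // -natrM ltr_nat.
  by move: uv; lia.
have vu2 : (v%:R : rat) <= u%:R / 2 by rewrite ler_pdivlMr // -natrM ler_nat; lia.
by rewrite (min_idPr vu2) -[v%:R]/(v%:Z%:~R) intrKfloor.
Qed.

(** If v(f'(s)) <= v(f(s)) / 2 then nu = v(f'(s)) and B1 is odd. Otherwise B1 is even,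
    and v(f(s)) = 2 nu + 1, since v(f(s)) = 2 nu would contradict regularity. *)
Lemma regular_maximal (a b c s : int) :
  irreducible_poly (quartic a b c) -> ~~ (2 %| a)%Z -> (2 %| b)%Z -> (2 %| c)%Z ->
  regular 2 (quartic a b c) s ->
  exists N B0 B1, nu (quartic a b c) s = N%:Z /\ maximal_at a b c s N B0 B1.
Proof.
move=> irr oa eb ec reg.
have fs0 := horner_quartic_neq0 a b c s irr.
have efs := even_quartic a b c s oa eb ec.
rewrite (nuE _ _ fs0).
have [m0 om0 A0E] := odd_part _ fs0.
have v_gt0 : (0 < logn 2 `|(quartic a b c).[s]|)%N.
  rewrite lt0n; apply: contraNneq om0 => v0.
  by move: efs; rewrite A0E v0 expr0 mulr1.
set A0 := (quartic a b c).[s] in A0E fs0 v_gt0 *.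
set A1 := (quartic a b c)^`().[s].
have [u_le|v_lt] := boolP ((A1 == 0) || ((logn 2 `|A0|)./2 < logn 2 `|A1|)%N); last first.
  move: v_lt; rewrite negb_or -leqNgt => /andP[A10 vu].
  have [m1 om1 A1E] := odd_part _ A10.
  rewrite (negPf A10) (minn_idPr vu).
  exists (logn 2 `|A1|), (m0 * 2 ^+ (logn 2 `|A0| - (logn 2 `|A1|).*2)), m1.
  split=> //; split; last by left.
    rewrite -/A0 {1}A0E (_ : 4 = 2 ^+ 2) // -exprM mulrCA -exprD; congr (_ * _ ^+ _).
    by lia.
  by rewrite -/A1 {1}A1E mulrC.
have -> : (if A1 == 0 then (logn 2 `|A0|)./2
    else minn (logn 2 `|A0|)./2 (logn 2 `|A1|)) = (logn 2 `|A0|)./2.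
  by case: (A1 == 0) u_le => //= lt; apply/minn_idPl/ltnW.
set k := _./2 in u_le *.
have [B1 [eB1 A1E]] : exists B1, (2 %| B1)%Z /\ A1 = 2 ^+ k * B1.
  have [A10|A10] := eqVneq A1 0; first by exists 0; rewrite mulr0.
  rewrite (negPf A10) /= in u_le.
  have [m1 om1 A1E] := odd_part _ A10.
  exists (m1 * 2 ^+ (logn 2 `|A1| - k)); split.
    by rewrite -(subnSK u_le) exprS dvdz_mull // dvdz_mulr.
  by rewrite {1}A1E mulrCA -exprD subnKC // ltnW.
have v0E := odd_double_half (logn 2 `|A0|).
rewrite -/k in v0E.
exists k, (m0 * 2 ^+ odd (logn 2 `|A0|)), B1; split=> //; split=> //.
  rewrite -/A0 {1}A0E -{1}v0E (_ : 4 = 2 ^+ 2) // -exprM mulrCA -exprD -mul2n.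
  by congr (_ * _ ^+ _); lia.
right; split=> //.
case: (boolP (odd _)) => od; last first.
  case: (not_regular a b c s oa k fs0 _ _ _ reg).
  - by rewrite -/A0 -v0E (negPf od).
  - by move: v_gt0; rewrite -v0E (negPf od); case: (k).
  - by rewrite -/A1 => A10; rewrite (negPf A10) in u_le.
rewrite expr1; split; last by rewrite dvdz_mull.
by move: om0; clear; lia.
Qed.

(** * The integral bases *)

Lemma valuation_eq1 (z : int) : valuation 2 z = 1%E -> (2 %| z)%Z /\ ~~ (4 %| z)%Z.
Proof.
rewrite /valuation; case: eqVneq => // z0 [] /eqP; rewrite (eqr_nat _ _ 1) => /eqP vz.
have [m om ->] := odd_part z z0; rewrite vz expr1.
by move: om; clear; lia.
Qed.

Lemma valuation_gt1 (z : int) : (1 < valuation 2 z)%E -> (4 %| z)%Z.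
Proof.
rewrite /valuation; case: eqVneq => [->|z0]; first by rewrite dvdz0.
rewrite lte_fin (ltr_nat _ 1) => vz.
have [m om ->] := odd_part z z0.
by rewrite -(subnKC vz) exprD dvdz_mull // dvdz_mulr.
Qed.

Section Triangular.

Variables (a b c : int) (theta : algC).
Hypothesis f_irr : irreducible_poly (quartic a b c).
Hypothesis a_odd : ~~ (2 %| a)%Z.
Hypothesis b_even : (2 %| b)%Z.
Hypothesis c_even : (2 %| c)%Z.
Hypothesis f_theta : root (map_poly intr (quartic a b c)) theta.
Variables (s : int) (N : nat) (B0 B1 : int).
Variables (N' : nat) (B0' B1' : int).
Hypothesis f_s : maximal_at a b c s N B0 B1.
Hypothesis f_s' : maximal_at a b c (s + 1) N' B0' B1'.

Lemma triangular_basis (k m : nat) (e d0 d1 d2 : int) :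
  let w2 := (theta ^+ 2 + e%:~R * theta) / 2 ^+ k in
  let w3 := (theta ^+ 3 + d2%:~R * theta ^+ 2 + d1%:~R * theta + d0%:~R) / 2 ^+ m in
  let w := [tuple 1; theta; w2; w3] in
  int2 w2 -> int2 w3 ->
  lspan in_Z2 4 (tnth w) (alpha a b s theta / 2 ^+ N) ->
  lspan in_Z2 4 (tnth w) (alpha a b (s + 1) theta / 2 ^+ N') ->
  is_2_integral_basis theta w.
Proof.
move=> w2 w3 w O2 O3 Sy Sy'.
have n2 j : (2 : algC) ^+ j != 0 by rewrite expf_neq0 // pnatr_eq0.
have Otheta : int2 theta by have := int2_root _ _ _ _ 0 f_theta; rewrite subr0.
have K (r0 r1 r2 r3 : rat) x : x = ratr r0 + ratr r1 * theta + ratr r2 * theta ^+ 2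
    + ratr r3 * theta ^+ 3 -> in_Qadjoin theta x.
  move=> Ex; apply/(Qadjoin_cubic a b c theta f_irr f_theta).
  exists (fun i => [:: r0; r1; r2; r3]`_i); split=> //.
  by rewrite Ex !big_ord_recl big_ord0 /= addr0 expr0 expr1 mulr1 !addrA.
apply: (basis_criterion a b c theta f_irr a_odd b_even c_even f_theta
  s N B0 B1 N' B0' B1' f_s f_s').
- case=> -[|[|[|[|i]]]] // lt_i; rewrite (tnth_nth 0) /=; apply/in_2_integersE; split=> //.
  + by apply: (K 1 0 0 0); rewrite rmorph1 rmorph0; ring.
  + exact: (int2_int 1).
  + by apply: (K 0 1 0 0); rewrite rmorph1 rmorph0; ring.
  + apply: (K 0 (e%:~R / 2 ^+ k) (2 ^- k) 0).
    by rewrite fmorph_div fmorphV rmorph0 rmorphXn rmorph_int rmorph_nat /w2; field.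
  apply: (K (d0%:~R / 2 ^+ m) (d1%:~R / 2 ^+ m) (d2%:~R / 2 ^+ m) (2 ^- m)).
  by rewrite !fmorph_div fmorphV !rmorphXn !rmorph_int !rmorph_nat /w3; field.
- have E2 : theta ^+ 2 = 2 ^+ k * w2 - e%:~R * theta by rewrite /w2; field.
  case=> -[|[|[|[|i]]]] // lt_i; rewrite /local_basis /=.
  + apply: (lspan4_int _ _ _ _ _ (s ^+ 2 + 1) (- (e + 2 * s)) (2 ^+ k) 0).
    transitivity (theta ^+ 2 - 2 * s%:~R * theta + s%:~R ^+ 2 + 1); first by ring.
    by rewrite E2 !(rmorphN, intrD, intrM, rmorphXn) /= ?intrD ?intrM; ring.
  + apply: (lspan4_int _ _ _ _ _ (s ^+ 2) (- (e + 2 * s)) (2 ^+ k) 0).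
    transitivity (theta ^+ 2 - 2 * s%:~R * theta + s%:~R ^+ 2); first by ring.
    by rewrite E2 !(rmorphN, intrD, intrM, rmorphXn) /= ?intrD ?intrM; ring.
exact: (triangular_free a b c theta f_irr f_theta).
Qed.

(** The difference of the alpha at s + 1 and at s expresses the element of the local
    basis at s + 1 through the given family and shows, when N' = 1, that
    (theta^2 + theta) / 2 is 2-integral. *)
Lemma alpha_basis : (N' <= 1)%N -> (N' <= N)%N ->
  is_2_integral_basis theta
    [tuple 1; theta; (theta ^+ 2 + N'%:Z%:~R * theta) / 2 ^+ N'; alpha a b s theta / 2 ^+ N].
Proof.
move=> N'1 N'N.
have n2 j : (2 : algC) ^+ j != 0 by rewrite expf_neq0 // pnatr_eq0.
have Otheta : int2 theta by have := int2_root _ _ _ _ 0 f_theta; rewrite subr0.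
have Oy := int2_scaled_alpha _ _ _ _ f_theta _ _ _ _ f_s.
have Oy' := int2_scaled_alpha _ _ _ _ f_theta _ _ _ _ f_s'.
set w2 := (_ + _) / _.
have [n1 [n0 Ey']] : exists n1 n0 : int, alpha a b (s + 1) theta / 2 ^+ N'
    = n0%:~R * 1 + n1%:~R * theta + 1%:~R * w2 + (2 ^+ (N - N'))%:~R * (alpha a b s theta / 2 ^+ N).
  have -> : (2 ^+ (N - N'))%:~R * (alpha a b s theta / 2 ^+ N) = alpha a b s theta / 2 ^+ N'.
    rewrite -[in 2 ^+ N](subnK N'N) exprD rmorphXn /=; field; exact/andP.
  rewrite alpha_diff /w2; have := N'1; rewrite leq_eqVlt ltnS leqn0 => /orP[] /eqP->.
    have [l El] : exists l, 3 * s ^+ 2 + 3 * s + 1 + a = 2 * l.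
      have [m ->] : exists m, a = 2 * m + 1 by exists (a %/ 2)%Z; lia.
      have [r [->|->]] : exists r, s = 2 * r \/ s = 2 * r + 1 by exists (s %/ 2)%Z; lia.
        by exists (6 * r ^+ 2 + 3 * r + 1 + m); ring.
      by exists (6 * r ^+ 2 + 9 * r + 4 + m); ring.
    by exists s, l; rewrite El !(intrD, intrM) /=; field.
  by exists (2 * s + 1), (3 * s ^+ 2 + 3 * s + 1 + a); rewrite /= expr0 !divr1; ring.
have -> : alpha a b s theta = theta ^+ 3 + s%:~R * theta ^+ 2 + (a + s ^+ 2)%:~R * theta
  + (s ^+ 3 + a * s + b)%:~R by [].
apply: triangular_basis.
- have -> : (theta ^+ 2 + N'%:Z%:~R * theta) / 2 ^+ N' = alpha a b (s + 1) theta / 2 ^+ N'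
    - n0%:~R - n1%:~R * theta - (2 ^+ (N - N'))%:~R * (alpha a b s theta / 2 ^+ N).
    by rewrite -/w2 Ey'; ring.
  by do ![exact: Oy' | exact: Oy | exact: int2_int | assumption | apply: int2B | apply: int2M].
- exact: Oy.
- apply: (lspan4_int _ _ _ _ _ 0 0 0 1).
  by rewrite !mul0r !add0r mul1r.
exact: (lspan4_int _ _ _ _ _ n0 n1 1 (2 ^+ (N - N'))).
Qed.

End Triangular.

Section Places.

Variables (a b c s : int).
Hypothesis a_odd : ~~ (2 %| a)%Z.
Hypothesis b_even : (2 %| b)%Z.
Hypothesis c_even : (2 %| c)%Z.

Lemma quartic_mod4_even : (2 %| s)%Z -> (4 %| (quartic a b c).[s] - c)%Z.
Proof.
case/dvdzP: b_even => b' -> /dvdzP[r ->]; apply/dvdzP; rewrite horner_quartic.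
by exists (4 * r ^+ 4 + a * r ^+ 2 + b' * r); ring.
Qed.

Lemma quartic_mod4_odd : ~~ (2 %| s)%Z -> (4 %| (quartic a b c).[s] - (a + b + c + 1))%Z.
Proof.
move=> os; have [r ->] : exists r, s = 2 * r + 1.
  by exists (s %/ 2)%Z; move: os; clear; lia.
case/dvdzP: b_even => b' ->; apply/dvdzP; rewrite horner_quartic.
by exists (4 * r ^+ 4 + 8 * r ^+ 3 + 6 * r ^+ 2 + 2 * r + a * (r ^+ 2 + r) + b' * r); ring.
Qed.

Lemma maximal_at_eisenstein : ~~ (4 %| (quartic a b c).[s])%Z ->
  maximal_at a b c s 0 (quartic a b c).[s] (quartic a b c)^`().[s].
Proof.
move=> n4; split; rewrite ?mul1r //; right.
by split; [exact: even_deriv_quartic | split=> //; exact: even_quartic].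
Qed.

Lemma maximal_at_unramified :
  (4 %| (quartic a b c).[s])%Z -> ~~ (4 %| (quartic a b c)^`().[s])%Z ->
  maximal_at a b c s 1 ((quartic a b c).[s] %/ 4)%Z ((quartic a b c)^`().[s] %/ 2)%Z.
Proof.
move=> d4 n4; have e' := even_deriv_quartic a b c s b_even.
move: n4 e' d4; set u := _.[s]; set v := _.[s] => n4 e' d4.
by split; rewrite ?expr1 1?mulrC ?divzK //; left; move: n4 e'; clear; lia.
Qed.

(** With N = 0, B0 = f(s) would be divisible by 4 and B1 = f'(s) would be even, which
    maximal_at excludes. *)
Lemma maximal_at_gt0 (N : nat) (B0 B1 : int) : maximal_at a b c s N B0 B1 ->
  (4 %| (quartic a b c).[s])%Z -> (0 < N)%N.
Proof.
move=> [E0 E1 B] d4; rewrite lt0n; apply: contraTneq d4 => N0.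
have := even_deriv_quartic a b c s b_even.
rewrite E0 E1 N0 !mul1r => e; case: B => [|[_ []]//].
by rewrite e.
Qed.

End Places.

Theorem mainTheorem7 (a b c : int) (theta : algC)
  (f_irr : irreducible_poly (quartic a b c))
  (a_odd : ~~ (2 %| a)%Z) (b_even : (2 %| b)%Z) (c_even : (2 %| c)%Z)
  (f_theta : root (map_poly intr (quartic a b c)) theta) :
  [/\ valuation 2 c = 1%E -> valuation 2 (a + b + c + 1) = 1%E ->
      is_2_integral_basis theta [tuple 1; theta; theta ^+ 2; theta ^+ 3],
      valuation 2 c = 1%E -> (1 < valuation 2 (a + b + c + 1))%E ->
      forall s : int, ~~ (2 %| s)%Z -> regular 2 (quartic a b c) s ->
      is_2_integral_basis theta
        [tuple 1; theta; theta ^+ 2;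
               alpha a b s theta / 2%:R ^ nu (quartic a b c) s],
      (1 < valuation 2 c)%E -> valuation 2 (a + b + c + 1) = 1%E ->
      forall s : int, (2 %| s)%Z -> regular 2 (quartic a b c) s ->
      is_2_integral_basis theta
        [tuple 1; theta; theta ^+ 2;
               alpha a b s theta / 2%:R ^ nu (quartic a b c) s]
    & (1 < valuation 2 c)%E -> (1 < valuation 2 (a + b + c + 1))%E ->
      forall s : int,
      ((a = 1 %[mod 4])%Z /\ ~~ (2 %| s)%Z \/
       (a = 3 %[mod 4])%Z /\ (2 %| s)%Z) ->
      regular 2 (quartic a b c) s ->
      is_2_integral_basis theta
        [tuple 1; theta; (theta ^+ 2 + theta) / 2%:R;
               alpha a b s theta / 2%:R ^ nu (quartic a b c) s]].
Proof.
have E2 : (theta ^+ 2 + 0%:Z%:~R * theta) / 2 ^+ 0 = theta ^+ 2.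
  by rewrite mul0r addr0 divr1.
have ev s : (2 %| s)%Z -> ~~ (4 %| c)%Z -> ~~ (4 %| (quartic a b c).[s])%Z.
  move=> /(quartic_mod4_even a b c s b_even); set u := _.[s]; lia.
have od s : ~~ (2 %| s)%Z -> ~~ (4 %| a + b + c + 1)%Z -> ~~ (4 %| (quartic a b c).[s])%Z.
  move=> /(quartic_mod4_odd a b c s b_even); set u := _.[s]; lia.
(* The place of s + 1 is ramified with N' = 0 as soon as 4 does not divide f(s + 1). *)
have ramified s : regular 2 (quartic a b c) s -> ~~ (4 %| (quartic a b c).[s + 1])%Z ->
    is_2_integral_basis theta
      [tuple 1; theta; theta ^+ 2; alpha a b s theta / 2%:R ^ nu (quartic a b c) s].
  move=> reg n4.
  have [N [B0 [B1 [-> Ms]]]] := regular_maximal a b c s f_irr a_odd b_even c_even reg.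
  have Ms' := maximal_at_eisenstein a b c (s + 1) a_odd b_even c_even n4.
  rewrite -E2.
  exact: (alpha_basis a b c theta f_irr a_odd b_even c_even f_theta _ _ _ _ _ _ _ Ms Ms').
split.
- move=> /valuation_eq1[_ n4] /valuation_eq1[_ n4'].
  (* Both places, here those of 0 and 1, have N = 0. *)
  have Ms := maximal_at_eisenstein a b c 0 a_odd b_even c_even (ev 0 isT n4).
  have Ms' := maximal_at_eisenstein a b c (0 + 1) a_odd b_even c_even (od 1 isT n4').
  have E3 : (theta ^+ 3 + 0%:~R * theta ^+ 2 + 0%:~R * theta + 0%:~R) / 2 ^+ 0 = theta ^+ 3.
    by rewrite !mul0r !addr0 divr1.
  have Otheta : int2 theta by have := int2_root _ _ _ _ 0 f_theta; rewrite subr0.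
  have := triangular_basis a b c theta f_irr a_odd b_even c_even f_theta _ _ _ _ _ _ _ Ms Ms' 0 0 0 0 0 0.
  rewrite /= E2 E3; apply.
  + exact: int2X.
  + exact: int2X.
  + apply: (lspan4_int _ _ _ _ _ b a 0 1).
    by rewrite /alpha divr1 !(expr0n, mul0r, mulr0, addr0, add0r) /=; ring.
  apply: (lspan4_int _ _ _ _ _ (1 + a + b) (a + 1) 1 1).
  by rewrite /alpha divr1 add0r expr1n mulr1 !intrD; ring.
- move=> /valuation_eq1[_ n4] _ s os reg; apply: ramified reg _.
  by apply: ev => //; move: os; lia.
- move=> _ /valuation_eq1[_ n4] s es reg; apply: ramified reg _.
  by apply: od => //; move: es; lia.
move=> /valuation_gt1 c4 /valuation_gt1 f4 s as_ reg.
have all4 r : (4 %| (quartic a b c).[r])%Z.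
  have [er|or] := boolP (2 %| r)%Z.
    by have := quartic_mod4_even a b c r b_even er; set u := _.[r]; lia.
  by have := quartic_mod4_odd a b c r b_even or; set u := _.[r]; lia.
(* The parity of s imposed by a modulo 4 is what makes f'(s + 1) = 2 modulo 4. *)
have n4 : ~~ (4 %| (quartic a b c)^`().[s + 1])%Z.
  rewrite horner_deriv_quartic.
  have [m am] : exists m, a = 2 * m + 1 by exists (a %/ 2)%Z; lia.
  have [r [sE|sE]] : exists r, s = 2 * r \/ s = 2 * r + 1 by exists (s %/ 2)%Z; lia.
    have -> : 4 * (s + 1) ^+ 3 + 2 * a * (s + 1) + b
      = 4 * ((s + 1) ^+ 3 + m + r * a) + 2 + b by rewrite sE am; ring.
    have b4 : (4 %| b)%Z by move: as_ c4 f4 sE; clear; lia.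
    by move: (_ + r * a) b4; clear; lia.
  have -> : 4 * (s + 1) ^+ 3 + 2 * a * (s + 1) + b = 4 * ((s + 1) ^+ 3 + a * (r + 1)) + b.
    by rewrite sE; ring.
  have b4 : (4 %| b - 2)%Z by move: as_ c4 f4 sE b_even; clear; lia.
  by move: (_ + a * _) b4; clear; lia.
have [N [B0 [B1 [-> Ms]]]] := regular_maximal a b c s f_irr a_odd b_even c_even reg.
have Ms' := maximal_at_unramified a b c (s + 1) b_even (all4 _) n4.
have N_gt0 := maximal_at_gt0 a b c s b_even N B0 B1 Ms (all4 s).
have := alpha_basis a b c theta f_irr a_odd b_even c_even f_theta _ _ _ _ _ _ _ Ms Ms' isT N_gt0.
by rewrite mul1r expr1.
Qed.
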